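(* Let $\mathcal C,\mathcal D$ be dg categories and let $\mathbf E\in\{\mathbf S,\mathbf A,\mathbf{Tw}\}$. Then the operation $\ast_{\mathbf E}$ defined by the formulas below is a fully faithful dg functor $\mathbf E(\mathcal C)\otimes\mathbf E(\mathcal D)\hookrightarrow\mathbf E(\mathcal C\otimes\mathcal D)$. ($\mathbf E=\mathbf S$) On objects $q^iX\ast_{\mathbf S}q^jY:=q^{i+j}(X\otimes Y)$; for $f\in\mathrm{Hom}^k_{\mathcal C}(X,X')$, $g\in\mathrm{Hom}^l_{\mathcal D}(Y,Y')$ and $i,i',j,j'\in\Gamma$, $$f^{i'}_i\ast_{\mathbf S}g^{j'}_j:=(-1)^{\langle k,j'\rangle+\langle i,j'+l+j\rangle}(f\otimes g)^{i'+j'}_{i+j}.$$ ($\mathbf E=\mathbf A$) On objects $\bigl(\bigoplus_{a\in A}X_a\bigr)\ast_{\mathbf A}\bigl(\bigoplus_{b\in B}Y_b\bigr):=\bigoplus_{(a,b)\in A\times B}X_a\otimes Y_b$; on morphisms $(f\ast_{\mathbf A}g)_{(a,b),(a',b')}:=f_{a,a'}\otimes g_{b,b'}$. ($\mathbf E=\mathbf{Tw}$) On objects $\mathrm{tw}_\alpha(X)\ast_{\mathbf{Tw}}\mathrm{tw}_\beta(Y):=\mathrm{tw}_{\alpha\otimes\mathrm{id}+\mathrm{id}\otimes\beta}(X\otimes Y)$; on morphisms $f\ast_{\mathbf{Tw}}g:=f\otimes g$.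
   Context: **Ground conventions.** Fix a commutative ring $K$, an abelian group $\Gamma$, a symmetric bilinear form $\langle\ ,\ \rangle\colon\Gamma\times\Gamma\to\mathbb Z/2$ and $\iota\in\Gamma$ with $\langle\iota,\iota\rangle=1$. A dg module is a $\Gamma$-graded $K$-module with a differential of degree $\iota$ squaring to zero; only homogeneous elements are considered and $|f|$ denotes degree. Tensor products over $K$ have differential $d(m\otimes n)=dm\otimes n+(-1)^{\langle\iota,|m|\rangle}m\otimes dn$. A dg category is a category enriched in dg modules over $K$, so $d(f\circ g)=d(f)\circ g+(-1)^{\langle\iota,|f|\rangle}f\circ d(g)$. **Tensor product.** $\mathcal C\otimes\mathcal D$ has objects pairs, written $X\otimes Y$, hom complexes $\mathrm{Hom}_{\mathcal C}(X,X')\otimes\mathrm{Hom}_{\mathcal D}(Y,Y')$, and composition $(f'\otimes g')\circ(f\otimes g)=(-1)^{\langle|g'|,|f|\rangle}(f'\circ f)\otimes(g'\circ g)$. **Envelopes.** $\mathbf S(\mathcal C)$: objects $q^iX$ ($i\in\Gamma$, $X\in\mathcal C$), $\mathrm{Hom}^l(q^iX,q^jY)=\mathrm{Hom}^{l+i-j}_{\mathcal C}(X,Y)$; for $f\in\mathrm{Hom}^k_{\mathcal C}(X,Y)$ the corresponding element of $\mathrm{Hom}^{k+j-i}(q^iX,q^jY)$ is written $f^j_i$, with $d(f^j_i)=(-1)^{\langle\iota,j\rangle}d(f)^j_i$ and $g^m_j\circ f^j_i=(g\circ f)^m_i$. $\mathbf A(\mathcal C)$: objects formal expressions $\bigoplus_{a\in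 A}X_a$ with $A$ a finite set and $X_a\in\mathcal C$; morphisms $\bigoplus_{a'\in A'}X'_{a'}\to\bigoplus_{a\in A}X_a$ are $A\times A'$ matrices $(f_{a,a'})$, $f_{a,a'}\in\mathrm{Hom}_{\mathcal C}(X'_{a'},X_a)$, composed by matrix multiplication, with componentwise differential. $\mathbf{Tw}(\mathcal C)$: objects $\mathrm{tw}_\alpha(X)$ with $\alpha\in\mathrm{End}^\iota_{\mathcal C}(X)$, $d(\alpha)+\alpha^2=0$; $\mathrm{Hom}(\mathrm{tw}_\alpha(X),\mathrm{tw}_\beta(Y))=\mathrm{Hom}_{\mathcal C}(X,Y)$ as graded modules, same composition, with differential $f\mapsto d_{\mathcal C}(f)+\beta\circ f-(-1)^{\langle\iota,|f|\rangle}f\circ\alpha$. *)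

(* Defs.v *)
From HB Require Import structures.
From mathcomp Require Import all_boot all_order all_algebra.
From mathcomp Require Import ring generic_quotient boolp.
Set Implicit Arguments.
Unset Strict Implicit.
Unset Printing Implicit Defensive.
Import GRing.Theory.
Local Open Scope ring_scope.

Record ground := Ground {
  scalars : comPzRingType;
  degrees : zmodType;
  pairing : degrees -> degrees -> 'Z_2;
  diota : degrees;
  pairingDl : forall a b c, pairing (a + b) c = pairing a c + pairing b c;
  pairingC : forall a b, pairing a b = pairing b a;
  pairing_iota : pairing diota diota = 1
}.

Definition sgn (g : ground) (a b : degrees g) : scalars g :=
  (-1) ^+ (pairing a b : nat).

Section SignTheory.
Variable g : ground.
Implicit Types a b c : degrees g.

Lemma signZ2 (R : pzRingType) (x y : 'Z_2) :
  (-1) ^+ ((x + y)%R : nat) = (-1) ^+ (x : nat) * (-1) ^+ (y : nat) :> R.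
Proof.
rewrite -exprD -signr_odd -[RHS]signr_odd.
case: x y => [x Hx] [y Hy].
case: x Hx => [|[|x]] //; case: y Hy => [|[|y]] //.
Qed.

Lemma sgnC a b : sgn a b = sgn b a.
Proof. by rewrite /sgn pairingC. Qed.
Lemma sgnDl a b c : sgn (a + b) c = sgn a c * sgn b c.
Proof. by rewrite /sgn pairingDl signZ2. Qed.
Lemma sgnDr a b c : sgn c (a + b) = sgn c a * sgn c b.
Proof. by rewrite !(sgnC c) sgnDl. Qed.
Lemma sgnK a b : sgn a b * sgn a b = 1.
Proof. by rewrite /sgn -expr2 sqrr_sign. Qed.
Lemma sgn0l a : sgn 0 a = 1.
Proof. by rewrite -(sgnK 0 a) -sgnDl addr0. Qed.
Lemma sgn0r a : sgn a 0 = 1.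
Proof. by rewrite sgnC sgn0l. Qed.
Lemma sgn_iota : sgn (diota g) (diota g) = -1.
Proof. by rewrite /sgn pairing_iota. Qed.
End SignTheory.

Section LinearTheory.
Variables (K : pzRingType) (U V : lmodType K) (f : U -> V).
Hypothesis linf : linear f.
Lemma linD x y : f (x + y) = f x + f y.
Proof. by have := linf 1 x y; rewrite !scale1r. Qed.
Lemma lin0 : f 0 = 0.
Proof. by apply: (addIr (f 0)); rewrite -linD !add0r. Qed.
Lemma linZ a x : f (a *: x) = a *: f x.
Proof. by have := linf a x 0; rewrite lin0 !addr0. Qed.
Lemma lin_sum (I : Type) (s : seq I) (F : I -> U) :
  f (\sum_(i <- s) F i) = \sum_(i <- s) f (F i).
Proof.
by elim: s => [|i s IH]; rewrite ?big_nil ?lin0 // !big_cons linD IH.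
Qed.
End LinearTheory.

(* Graded modules are families indexed by degree.  To avoid transports along
   equalities of degrees, operations take an equation relating the degrees of
   their arguments and of their result; it is irrelevant which proof is used
   (degrees form an eqType, so equality proofs are unique). *)
Record dgmod (g : ground) := DGMod {
  gr :> degrees g -> lmodType (scalars g);
  dif : forall i j, i + diota g = j -> gr i -> gr j;
  dif_linear : forall i j (e : i + diota g = j), linear (dif e);
  dif_dif : forall i j k (e : i + diota g = j) (e' : j + diota g = k) x,
    dif e' (dif e x) = 0
}.
Arguments dif {g d i j}.

Definition gcast (g : ground) (M : dgmod g) i j (e : i = j) (x : M i) : M j :=
  ecast k (M k) e x.

(* Degree k part of the tensor product of two graded modules: formal sums of
   symbols m (x) n with |m| + |n| = k, modulo the congruence generated by
   bilinearity. *)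
Section GradedTensor.
Variables (g : ground) (M N : degrees g -> lmodType (scalars g)).
Implicit Types a b k : degrees g.

Record pure k := Pure {
  pl : degrees g; pr : degrees g; pdeg : pl + pr = k; pm : M pl; pn : N pr }.
Arguments Pure {k pl pr}.

HB.instance Definition _ k := gen_eqMixin (pure k).
HB.instance Definition _ k := gen_choiceMixin (pure k).

Inductive tens_eq k : seq (pure k) -> seq (pure k) -> Prop :=
| te_refl s : tens_eq s s
| te_sym s t : tens_eq s t -> tens_eq t s
| te_trans s t u : tens_eq s t -> tens_eq t u -> tens_eq s u
| te_cat s s' t t' : tens_eq s s' -> tens_eq t t' -> tens_eq (s ++ t) (s' ++ t')
| te_comm s t : tens_eq (s ++ t) (t ++ s)
| te_zero a b (e : a + b = k) n : tens_eq [:: Pure e 0 n] [::]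
| te_addl a b (e : a + b = k) m m' n :
    tens_eq [:: Pure e (m + m') n] [:: Pure e m n; Pure e m' n]
| te_addr a b (e : a + b = k) m n n' :
    tens_eq [:: Pure e m (n + n')] [:: Pure e m n; Pure e m n']
| te_scale a b (e : a + b = k) c m n :
    tens_eq [:: Pure e (c *: m) n] [:: Pure e m (c *: n)].

Definition tens_eqb k (s t : seq (pure k)) : bool := `[< tens_eq s t >].

Lemma tens_eqb_refl k : reflexive (@tens_eqb k).
Proof. by move=> s; apply/asboolP; exact: te_refl. Qed.
Lemma tens_eqb_sym k : symmetric (@tens_eqb k).
Proof. by move=> s t; apply/asboolP/asboolP; exact: te_sym. Qed.
Lemma tens_eqb_trans k : transitive (@tens_eqb k).
Proof.
by move=> t s u /asboolP st /asboolP tu; apply/asboolP; exact: te_trans tu.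
Qed.

Definition tens_equiv k := EquivRel (@tens_eqb k)
  (@tens_eqb_refl k) (@tens_eqb_sym k) (@tens_eqb_trans k).

Definition tensor k : Type := {eq_quot tens_equiv k}%qT.
HB.instance Definition _ k := Choice.on (tensor k).
HB.instance Definition _ k := EqQuotient.on (tensor k).

Definition tclass k (s : seq (pure k)) : tensor k := (\pi_(tensor k) s)%qT.

Lemma tclassP k (s t : seq (pure k)) : tens_eq s t -> tclass s = tclass t.
Proof. by move=> st; apply/eqmodP/asboolP. Qed.

Lemma tclass_eq k (s t : seq (pure k)) : tclass s = tclass t -> tens_eq s t.
Proof. by move/eqmodP/asboolP. Qed.

Lemma tclass_repr k (x : tensor k) : tclass (repr x) = x.
Proof. exact: reprK. Qed.

Definition pscale k (c : scalars g) (p : pure k) : pure k :=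
  Pure (pdeg p) (c *: pm p) (pn p).

Definition tzero k : tensor k := tclass [::].
Definition tadd k (x y : tensor k) : tensor k := tclass (repr x ++ repr y).
Definition tscale k (c : scalars g) (x : tensor k) : tensor k :=
  tclass (map (pscale c) (repr x)).
Definition topp k (x : tensor k) : tensor k := tscale (-1) x.

Lemma tadd_class k (s t : seq (pure k)) :
  tadd (tclass s) (tclass t) = tclass (s ++ t).
Proof. by apply/tclassP/te_cat; apply: tclass_eq; rewrite tclass_repr. Qed.

Lemma te_pscale k c (s t : seq (pure k)) :
  tens_eq s t -> tens_eq (map (pscale c) s) (map (pscale c) t).
Proof.
elim=> {s t}.
- by move=> s; exact: te_refl.
- by move=> s t _ IH; exact: te_sym.
- by move=> s t u _ IH _ IH'; exact: te_trans IH'.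
- by move=> s s' t t' _ IH _ IH'; rewrite !map_cat; exact: te_cat.
- by move=> s t; rewrite !map_cat; exact: te_comm.
- by move=> a b e n /=; rewrite /pscale /= scaler0; exact: te_zero.
- by move=> a b e m m' n /=; rewrite /pscale /= scalerDr; exact: te_addl.
- by move=> a b e m n n' /=; exact: te_addr.
- move=> a b e d m n /=; rewrite /pscale /= scalerA mulrC -scalerA.
  exact: te_scale.
Qed.

Lemma tscale_class k c (s : seq (pure k)) :
  tscale c (tclass s) = tclass (map (pscale c) s).
Proof. by apply/tclassP/te_pscale/tclass_eq; rewrite tclass_repr. Qed.

Lemma tensorW k (P : tensor k -> Prop) :
  (forall s, P (tclass s)) -> forall x, P x.
Proof. by move=> H x; rewrite -[x]tclass_repr. Qed.

Lemma taddA k : associative (@tadd k).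
Proof.
elim/tensorW=> s; elim/tensorW=> t; elim/tensorW=> u.
by rewrite !tadd_class catA.
Qed.
Lemma taddC k : commutative (@tadd k).
Proof.
elim/tensorW=> s; elim/tensorW=> t.
by rewrite !tadd_class; apply/tclassP/te_comm.
Qed.
Lemma taddACA k : interchange (@tadd k) (@tadd k).
Proof. by move=> x y z t; rewrite -!taddA (taddA y) (taddC y) -taddA. Qed.
Lemma tadd0 k : left_id (@tzero k) (@tadd k).
Proof. by elim/tensorW=> s; rewrite tadd_class. Qed.
Lemma taddN k : left_inverse (@tzero k) (@topp k) (@tadd k).
Proof.
elim/tensorW=> s; rewrite /topp tscale_class.
elim: s => [|p s IH]; first by rewrite tadd_class.
rewrite /= -cat1s -[p :: s]cat1s -!tadd_class taddACA IH -[RHS]tadd0.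
congr tadd; rewrite tadd_class; apply/tclassP.
case: p => a b e m n; apply: te_trans (te_zero e n).
by rewrite -(addNr m) -scaleN1r; apply/te_sym/te_addl.
Qed.
HB.instance Definition _ k :=
  GRing.isZmodule.Build (tensor k) (@taddA k) (@taddC k) (@tadd0 k) (@taddN k).

Lemma taddE k (s t : seq (pure k)) : tclass s + tclass t = tclass (s ++ t).
Proof. exact: tadd_class. Qed.

Lemma tscalerA k c d (x : tensor k) : tscale c (tscale d x) = tscale (c * d) x.
Proof.
elim/tensorW: x => s; rewrite !tscale_class -map_comp; congr tclass.
by apply: eq_map => p; rewrite /= /pscale /= scalerA.
Qed.
Lemma tscale1r k : left_id 1 (@tscale k).
Proof.
elim/tensorW=> s; rewrite tscale_class; congr tclass; rewrite -[RHS]map_id.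
by apply: eq_map => -[a b e m n]; rewrite /pscale /= scale1r.
Qed.
Lemma tscalerDr k : right_distributive (@tscale k) +%R.
Proof.
move=> c; elim/tensorW=> s; elim/tensorW=> t.
by rewrite taddE !tscale_class taddE map_cat.
Qed.
Lemma tscalerDl k (x : tensor k) :
  {morph (@tscale k)^~ x : c d / c + d}.
Proof.
move=> c d; elim/tensorW: x => s; rewrite !tscale_class.
elim: s => [|p s IH] /=; first by rewrite taddE.
rewrite -cat1s -taddE IH -[in RHS]cat1s -[in X in _ = _ + X]cat1s -!taddE.
rewrite [RHS]addrACA; congr (_ + _).
rewrite taddE; apply/tclassP; rewrite /pscale scalerDl; exact: te_addl.
Qed.
HB.instance Definition _ k := GRing.Zmodule_isLmodule.Build (scalars g)
  (tensor k) (@tscalerA k) (@tscale1r k) (@tscalerDr k) (@tscalerDl k).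

Lemma tscaleE k c (s : seq (pure k)) :
  c *: tclass s = tclass (map (pscale c) s).
Proof. exact: tscale_class. Qed.

Definition tens k a b (e : a + b = k) (m : M a) (n : N b) : tensor k :=
  tclass [:: Pure e m n].

Lemma tens_irr k a b (e e' : a + b = k) m n : tens e m n = tens e' m n.
Proof. by rewrite (eq_irrelevance e e'). Qed.

Lemma tens_linl k a b (e : a + b = k) n : linear (fun m => tens e m n).
Proof.
move=> c m m'; rewrite /tens tscaleE taddE.
by apply/tclassP; exact: te_addl.
Qed.
Lemma tens_linr k a b (e : a + b = k) m : linear (tens e m).
Proof.
move=> c n n'; rewrite /tens tscaleE taddE.
apply/tclassP; apply: te_trans; first exact: te_addr.
apply: (@te_cat _ [:: Pure e m (c *: n)] _ [:: Pure e m n']).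
  by apply: te_sym; exact: te_scale.
exact: te_refl.
Qed.

Lemma tclassE k (s : seq (pure k)) :
  tclass s = \sum_(p <- s) tens (pdeg p) (pm p) (pn p).
Proof.
elim: s => [|[a b e m n] s IH]; first by rewrite big_nil.
by rewrite big_cons -IH -cat1s -taddE.
Qed.

Lemma tensor_ind k (P : tensor k -> Prop) :
  P 0 -> (forall x y, P x -> P y -> P (x + y)) ->
  (forall a b (e : a + b = k) m n, P (tens e m n)) -> forall x, P x.
Proof.
move=> P0 PD Pt; elim/tensorW=> s; rewrite tclassE.
elim: s => [|p s IH]; first by rewrite big_nil.
by rewrite big_cons; apply: PD.
Qed.

Definition tlift k (V : lmodType (scalars g))
    (h : forall a b, a + b = k -> M a -> N b -> V) (x : tensor k) : V :=
  \sum_(p <- repr x) h _ _ (pdeg p) (pm p) (pn p).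

Section Lift.
Variables (k : degrees g) (V : lmodType (scalars g)).
Variable h : forall a b, a + b = k -> M a -> N b -> V.
Hypothesis hl : forall a b (e : a + b = k) n, linear (fun m => h e m n).
Hypothesis hr : forall a b (e : a + b = k) m, linear (h e m).

Let ev (s : seq (pure k)) : V := \sum_(p <- s) h (pdeg p) (pm p) (pn p).

Lemma tlift_ev s t : tens_eq s t -> ev s = ev t.
Proof.
rewrite /ev; elim=> {s t}.
- by [].
- by [].
- by move=> s t u _ -> _ ->.
- by move=> s s' t t' _ IH _ IH'; rewrite !big_cat /= IH IH'.
- by move=> s t; rewrite !big_cat /= addrC.
- by move=> a b e n; rewrite big_nil big_seq1 /=; exact: (lin0 (hl e n)).
- move=> a b e m m' n; rewrite !big_cons !big_nil !addr0 /=.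
  exact: (linD (hl e n)).
- by move=> a b e m n n'; rewrite !big_cons !big_nil !addr0 /= (linD (hr e m)).
- move=> a b e c m n; rewrite !big_seq1 /= (linZ (hr e m)).
  exact: (linZ (hl e n)).
Qed.

Lemma tlift_class s : tlift h (tclass s) = ev s.
Proof. by apply/tlift_ev/tclass_eq; rewrite tclass_repr. Qed.

Lemma tlift_tens a b (e : a + b = k) m n : tlift h (tens e m n) = h e m n.
Proof. by rewrite tlift_class /ev big_seq1. Qed.

Lemma tlift_linear : linear (tlift h).
Proof.
move=> c; elim/tensorW=> s; elim/tensorW=> t.
rewrite tscaleE taddE !tlift_class /ev big_cat /= big_map.
congr (_ + _); rewrite scaler_sumr; apply: eq_bigr => p _ /=.
exact: (linZ (hl (pdeg p) (pn p))).
Qed.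
End Lift.

Lemma tensor_lin_ext k (V : lmodType (scalars g)) (f h : tensor k -> V) :
  linear f -> linear h ->
  (forall a b (e : a + b = k) m n, f (tens e m n) = h (tens e m n)) ->
  forall x, f x = h x.
Proof.
move=> lf lh E; apply: tensor_ind => //; first by rewrite !lin0.
by move=> x y Ex Ey; rewrite !linD // Ex Ey.
Qed.
End GradedTensor.

Section LinearClosure.
Variables (K : comPzRingType) (U V W : lmodType K).
Lemma lin_comp (f : V -> W) (h : U -> V) :
  linear f -> linear h -> linear (fun x => f (h x)).
Proof. by move=> lf lh a x y; rewrite lh lf. Qed.
Lemma lin_add (f h : U -> V) :
  linear f -> linear h -> linear (fun x => f x + h x).
Proof. by move=> lf lh a x y; rewrite lh lf scalerDr addrACA. Qed.
Lemma lin_scale (f : U -> V) c : linear f -> linear (fun x => c *: f x).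
Proof.
by move=> lf a x y; rewrite lf scalerDr !scalerA mulrC.
Qed.
Lemma lin_bigsum (I : Type) (s : seq I) (F : I -> U -> V) :
  (forall i, linear (F i)) -> linear (fun x => \sum_(i <- s) F i x).
Proof.
move=> lF a x y; rewrite scaler_sumr -big_split /=.
by apply: eq_bigr => i _; exact: lF.
Qed.
End LinearClosure.

Lemma sgnN (g : ground) (a b : degrees g) : sgn a (- b) = sgn a b.
Proof.
by rewrite -[LHS]mulr1 -(sgnK a b) mulrA -sgnDr addNr sgn0r mul1r.
Qed.

Lemma dif_irr (g : ground) (M : dgmod g) i j (e e' : i + diota g = j)
  (x : M i) : dif e x = dif e' x.
Proof. by rewrite (eq_irrelevance e e'). Qed.

Lemma deg_dl (G : zmodType) (c a b i j : G) :
  a + b = i -> i + c = j -> (a + c) + b = j.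
Proof. by move=> <- <-; rewrite addrAC. Qed.
Lemma deg_dr (G : zmodType) (c a b i j : G) :
  a + b = i -> i + c = j -> a + (b + c) = j.
Proof. by move=> <- <-; rewrite addrA. Qed.
Lemma deg_cc (G : zmodType) (a b c d i j k : G) :
  a + b = i -> c + d = j -> i + j = k -> (a + c) + (b + d) = k.
Proof. by move=> <- <- <-; rewrite addrACA. Qed.

Section TensorDGMod.
Variables (g : ground) (M N : dgmod g).

Definition tdif i j (e : i + diota g = j) : tensor M N i -> tensor M N j :=
  tlift (fun a b (eab : a + b = i) (m : M a) (n : N b) =>
    tens (deg_dl eab e) (dif erefl m) n +
    sgn (diota g) a *: tens (deg_dr eab e) m (dif erefl n)).

Let hl i j (e : i + diota g = j) a b (eab : a + b = i) (n : N b) :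
  linear (fun m : M a => tens (deg_dl eab e) (dif erefl m) n +
    sgn (diota g) a *: tens (deg_dr eab e) m (dif erefl n)).
Proof.
apply: lin_add; last exact/lin_scale/tens_linl.
exact: (lin_comp (tens_linl (deg_dl eab e) n) (dif_linear _)).
Qed.
Let hr i j (e : i + diota g = j) a b (eab : a + b = i) (m : M a) :
  linear (fun n : N b => tens (deg_dl eab e) (dif erefl m) n +
    sgn (diota g) a *: tens (deg_dr eab e) m (dif erefl n)).
Proof.
apply: lin_add; first exact: tens_linr.
apply: lin_scale.
exact: (lin_comp (tens_linr (deg_dr eab e) m) (dif_linear _)).
Qed.

Lemma tdif_linear i j (e : i + diota g = j) : linear (tdif e).
Proof. exact: tlift_linear (hl e) (hr e). Qed.

Lemma tdif_tens i j (e : i + diota g = j) a b a' b' (eab : a + b = i)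
    (ea : a + diota g = a') (eb : b + diota g = b')
    (el : a' + b = j) (er : a + b' = j) (m : M a) (n : N b) :
  tdif e (tens eab m n) = tens el (dif ea m) n +
    sgn (diota g) a *: tens er m (dif eb n).
Proof.
rewrite /tdif (tlift_tens (hl e) (hr e)); subst a' b'.
by congr (_ + _ *: _); exact: tens_irr.
Qed.

Lemma tdif_tdif i j k (e : i + diota g = j) (e' : j + diota g = k)
  (x : tensor M N i) : tdif e' (tdif e x) = 0.
Proof.
apply: (tensor_lin_ext (f := fun y => tdif e' (tdif e y)) (h := fun=> 0)).
- exact: lin_comp (tdif_linear e') (tdif_linear e).
- by move=> a y z; rewrite scaler0 addr0.
move=> a b eab m n.
rewrite (tdif_tens _ _ erefl erefl (deg_dl eab e) (deg_dr eab e)).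
rewrite (linD (tdif_linear _)) (linZ (tdif_linear _)).
have e1 : a + diota g + diota g + b = k.
  by rewrite -e' -(deg_dl eab e) addrAC.
have e2 : a + diota g + (b + diota g) = k by rewrite -e' -e -eab addrACA addrA.
have e3 : a + (b + diota g + diota g) = k by rewrite -e' -e -eab !addrA.
rewrite (tdif_tens _ _ erefl erefl e1 e2) (tdif_tens _ _ erefl erefl e2 e3).
rewrite !dif_dif (lin0 (tens_linl _ _)) (lin0 (tens_linr _ _)) add0r.
rewrite scaler0 addr0.
by rewrite sgnDr sgn_iota mulrN1 scaleNr addNr.
Qed.

Definition tensor_dgmod : dgmod g :=
  @DGMod g (fun k => tensor M N k) tdif tdif_linear tdif_tdif.
End TensorDGMod.

(* cmp e f h is the composite f o h; the axioms say that composition is a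
   chain map on tensor products, i.e., bilinear and satisfying the Leibniz
   rule, that it is associative and unital, and that identities are closed. *)
Record dgcat (g : ground) := DGCat {
  obj :> Type;
  dghom : obj -> obj -> dgmod g;
  dgid : forall X, dghom X X 0;
  cmp : forall X Y Z i j k, i + j = k ->
    dghom Y Z i -> dghom X Y j -> dghom X Z k;
  cmp_linl : forall X Y Z i j k (e : i + j = k) (h : dghom X Y j),
    linear (fun f : dghom Y Z i => cmp e f h);
  cmp_linr : forall X Y Z i j k (e : i + j = k) (f : dghom Y Z i),
    linear (fun h : dghom X Y j => cmp e f h);
  cmpA : forall W X Y Z i j k ij jk l
    (e1 : i + j = ij) (e2 : ij + k = l) (e3 : j + k = jk) (e4 : i + jk = l)
    (f : dghom Y Z i) (h : dghom X Y j) (u : dghom W X k),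
    cmp e4 f (cmp e3 h u) = cmp e2 (cmp e1 f h) u;
  cmp1l : forall X Y i (e : 0 + i = i) (f : dghom X Y i), cmp e (dgid Y) f = f;
  cmp1r : forall X Y i (e : i + 0 = i) (f : dghom X Y i), cmp e f (dgid X) = f;
  dif_dgid : forall X i (e : 0 + diota g = i), dif e (dgid X) = 0;
  dif_cmp : forall X Y Z i j k i' j' l (e : i + j = k)
    (ek : k + diota g = l) (ei : i + diota g = i') (ej : j + diota g = j')
    (e1 : i' + j = l) (e2 : i + j' = l) (f : dghom Y Z i) (h : dghom X Y j),
    dif ek (cmp e f h) =
      cmp e1 (dif ei f) h + sgn (diota g) i *: cmp e2 f (dif ej h)
}.
Arguments dghom {g C} X Y : rename.
Arguments dgid {g C} X : rename.
Arguments cmp {g C X Y Z i j k} e f h : rename.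

Section CmpTheory.
Variables (g : ground) (C : dgcat g) (X Y Z : C) (i j k : degrees g).
Variable e : i + j = k.
Implicit Types (f : dghom Y Z i) (h : dghom X Y j).
Lemma cmp_irr (e' : i + j = k) f h : cmp e f h = cmp e' f h.
Proof. by rewrite (eq_irrelevance e e'). Qed.
Lemma cmp0l h : cmp e (0 : dghom Y Z i) h = 0.
Proof. exact: (lin0 (cmp_linl e h)). Qed.
Lemma cmp0r f : cmp e f (0 : dghom X Y j) = 0.
Proof. exact: (lin0 (cmp_linr e f)). Qed.
Lemma cmpDl f f' h : cmp e (f + f') h = cmp e f h + cmp e f' h.
Proof. exact: (linD (cmp_linl e h)). Qed.
Lemma cmpDr f h h' : cmp e f (h + h') = cmp e f h + cmp e f h'.
Proof. exact: (linD (cmp_linr e f)). Qed.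
Lemma cmpZl c f h : cmp e (c *: f) h = c *: cmp e f h.
Proof. exact: (linZ (cmp_linl e h)). Qed.
Lemma cmpZr c f h : cmp e f (c *: h) = c *: cmp e f h.
Proof. exact: (linZ (cmp_linr e f)). Qed.
Lemma cmp_suml (I : Type) (s : seq I) (F : I -> dghom Y Z i) h :
  cmp e (\sum_(a <- s) F a) h = \sum_(a <- s) cmp e (F a) h.
Proof. exact: (lin_sum (cmp_linl e h)). Qed.
Lemma cmp_sumr (I : Type) (s : seq I) f (F : I -> dghom X Y j) :
  cmp e f (\sum_(a <- s) F a) = \sum_(a <- s) cmp e f (F a).
Proof. exact: (lin_sum (cmp_linr e f)). Qed.
End CmpTheory.

Section DifTheory.
Variables (g : ground) (M : dgmod g) (i j : degrees g).
Variable e : i + diota g = j.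
Implicit Types x y : M i.
Lemma dif0 : dif e (0 : M i) = 0.
Proof. exact: (lin0 (dif_linear e)). Qed.
Lemma difD x y : dif e (x + y) = dif e x + dif e y.
Proof. exact: (linD (dif_linear e)). Qed.
Lemma difZ c x : dif e (c *: x) = c *: dif e x.
Proof. exact: (linZ (dif_linear e)). Qed.
Lemma dif_sum (I : Type) (s : seq I) (F : I -> M i) :
  dif e (\sum_(a <- s) F a) = \sum_(a <- s) dif e (F a).
Proof. exact: (lin_sum (dif_linear e)). Qed.
End DifTheory.

Section TensorDGCat.
Variables (g : ground) (C D : dgcat g).

Definition thom (P Q : C * D) : dgmod g :=
  tensor_dgmod (dghom P.1 Q.1) (dghom P.2 Q.2).

Definition tid (P : C * D) : thom P P 0 :=
  tens (addr0 0) (dgid P.1) (dgid P.2).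

(* (f1 (x) f2) o (h1 (x) h2) = (-1)^<|f2|, |h1|> (f1 o h1) (x) (f2 o h2) *)
Definition tcmp (P Q R : C * D) i j k (e : i + j = k)
    (f : thom Q R i) (h : thom P Q j) : thom P R k :=
  tlift (fun a b (eab : a + b = i) (f1 : dghom Q.1 R.1 a)
                                   (f2 : dghom Q.2 R.2 b) =>
    tlift (fun c d (ecd : c + d = j) (h1 : dghom P.1 Q.1 c)
                                     (h2 : dghom P.2 Q.2 d) =>
      sgn b c *: tens (deg_cc eab ecd e) (cmp erefl f1 h1) (cmp erefl f2 h2)) h)
  f.

Section TCmp.
Variables (P Q R : C * D) (i j k : degrees g) (e : i + j = k).

Let inl a b (eab : a + b = i) (f1 : dghom Q.1 R.1 a) (f2 : dghom Q.2 R.2 b)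
  c d (ecd : c + d = j) (h2 : dghom P.2 Q.2 d) :
  linear (fun h1 : dghom P.1 Q.1 c =>
  sgn b c *: tens (deg_cc eab ecd e) (cmp erefl f1 h1) (cmp erefl f2 h2)).
Proof.
apply: lin_scale.
exact: (lin_comp (tens_linl (deg_cc eab ecd e) _) (cmp_linr _ _)).
Qed.
Let inr a b (eab : a + b = i) (f1 : dghom Q.1 R.1 a) (f2 : dghom Q.2 R.2 b)
  c d (ecd : c + d = j) (h1 : dghom P.1 Q.1 c) :
  linear (fun h2 : dghom P.2 Q.2 d =>
  sgn b c *: tens (deg_cc eab ecd e) (cmp erefl f1 h1) (cmp erefl f2 h2)).
Proof.
apply: lin_scale.
exact: (lin_comp (tens_linr (deg_cc eab ecd e) _) (cmp_linr _ _)).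
Qed.

Let outl (h : thom P Q j) a b (eab : a + b = i) (f2 : dghom Q.2 R.2 b) :
  linear (fun f1 : dghom Q.1 R.1 a =>
    tlift (fun c d (ecd : c + d = j) (h1 : dghom P.1 Q.1 c)
                                     (h2 : dghom P.2 Q.2 d) =>
      sgn b c *: tens (deg_cc eab ecd e) (cmp erefl f1 h1) (cmp erefl f2 h2)) h).
Proof.
apply: lin_bigsum => p.
apply: lin_scale.
exact: (lin_comp (tens_linl (deg_cc eab _ e) _) (cmp_linl _ _)).
Qed.
Let outr (h : thom P Q j) a b (eab : a + b = i) (f1 : dghom Q.1 R.1 a) :
  linear (fun f2 : dghom Q.2 R.2 b =>
    tlift (fun c d (ecd : c + d = j) (h1 : dghom P.1 Q.1 c)
                                     (h2 : dghom P.2 Q.2 d) =>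
      sgn b c *: tens (deg_cc eab ecd e) (cmp erefl f1 h1) (cmp erefl f2 h2)) h).
Proof.
apply: lin_bigsum => p.
apply: lin_scale.
exact: (lin_comp (tens_linr (deg_cc eab _ e) _) (cmp_linl _ _)).
Qed.

Lemma tcmp_linl (h : thom P Q j) : linear (fun f : thom Q R i => tcmp e f h).
Proof. exact: tlift_linear (outl h) (outr h). Qed.

Lemma tcmp_linr (f : thom Q R i) : linear (fun h : thom P Q j => tcmp e f h).
Proof.
apply: lin_bigsum => p.
exact: tlift_linear (inl (pdeg p) (pm p) (pn p)) (inr (pdeg p) (pm p) (pn p)).
Qed.

Lemma tcmp_tens a b c d ac bd (eab : a + b = i) (ecd : c + d = j)
    (eac : a + c = ac) (ebd : b + d = bd) (e' : ac + bd = k)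
    (f1 : dghom Q.1 R.1 a) (f2 : dghom Q.2 R.2 b)
    (h1 : dghom P.1 Q.1 c) (h2 : dghom P.2 Q.2 d) :
  tcmp e (tens eab f1 f2) (tens ecd h1 h2) =
    sgn b c *: tens e' (cmp eac f1 h1) (cmp ebd f2 h2).
Proof.
rewrite /tcmp (tlift_tens (outl _) (outr _)).
rewrite (tlift_tens (inl eab f1 f2) (inr eab f1 f2)); subst ac bd.
by congr (_ *: _); exact: tens_irr.
Qed.
End TCmp.

Lemma thom_ind (P Q : C * D) k (T : thom P Q k -> Prop) :
  T 0 -> (forall x y, T x -> T y -> T (x + y)) ->
  (forall a b (e : a + b = k) m n, T (tens e m n)) -> forall x, T x.
Proof. exact: tensor_ind. Qed.

Section TCmpTheory.
Variables (P Q R : C * D) (i j k : degrees g) (e : i + j = k).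
Implicit Types (f : thom Q R i) (h : thom P Q j).
Lemma tcmp0l h : tcmp e (0 : thom Q R i) h = 0.
Proof. exact: (lin0 (tcmp_linl e h)). Qed.
Lemma tcmp0r f : tcmp e f (0 : thom P Q j) = 0.
Proof. exact: (lin0 (tcmp_linr e f)). Qed.
Lemma tcmpDl f f' h : tcmp e (f + f') h = tcmp e f h + tcmp e f' h.
Proof. exact: (linD (tcmp_linl e h)). Qed.
Lemma tcmpDr f h h' : tcmp e f (h + h') = tcmp e f h + tcmp e f h'.
Proof. exact: (linD (tcmp_linr e f)). Qed.
Lemma tcmpZl c f h : tcmp e (c *: f) h = c *: tcmp e f h.
Proof. exact: (linZ (tcmp_linl e h)). Qed.
Lemma tcmpZr c f h : tcmp e f (c *: h) = c *: tcmp e f h.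
Proof. exact: (linZ (tcmp_linr e f)). Qed.
End TCmpTheory.

Lemma tcmpA (W X Y Z : C * D) i j k ij jk l
    (e1 : i + j = ij) (e2 : ij + k = l) (e3 : j + k = jk) (e4 : i + jk = l)
    (f : thom Y Z i) (h : thom X Y j) (u : thom W X k) :
  tcmp e4 f (tcmp e3 h u) = tcmp e2 (tcmp e1 f h) u.
Proof.
elim/thom_ind: f => [|f f' IH IH'|a b eab f1 f2].
- by rewrite !tcmp0l.
- by rewrite !tcmpDl IH IH'.
elim/thom_ind: h => [|h h' IH IH'|c d ecd h1 h2].
- by rewrite !(tcmp0l, tcmp0r).
- by rewrite !(tcmpDl, tcmpDr) IH IH'.
elim/thom_ind: u => [|u u' IH IH'|p q epq u1 u2].
- by rewrite !tcmp0r.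
- by rewrite !tcmpDr IH IH'.
rewrite (tcmp_tens _ _ _ erefl erefl (deg_cc ecd epq e3)).
rewrite (tcmp_tens _ _ _ erefl erefl (deg_cc eab ecd e1)).
rewrite tcmpZl tcmpZr.
rewrite (tcmp_tens _ _ _ erefl erefl (deg_cc eab (deg_cc ecd epq e3) e4)).
rewrite (tcmp_tens _ _ _ (esym (addrA a c p)) (esym (addrA b d q))
   (deg_cc eab (deg_cc ecd epq e3) e4)).
rewrite (cmpA erefl (esym (addrA a c p))) (cmpA erefl (esym (addrA b d q))).
by rewrite !scalerA sgnDl sgnDr; congr (_ *: _); ring.
Qed.

Lemma tcmp1l (X Y : C * D) i (e : 0 + i = i) (f : thom X Y i) :
  tcmp e (tid Y) f = f.
Proof.
elim/thom_ind: f => [|f f' IH IH'|a b eab f1 f2].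
- by rewrite tcmp0r.
- by rewrite tcmpDr IH IH'.
by rewrite (tcmp_tens _ _ _ (add0r a) (add0r b) eab) !cmp1l sgn0l scale1r.
Qed.

Lemma tcmp1r (X Y : C * D) i (e : i + 0 = i) (f : thom X Y i) :
  tcmp e f (tid X) = f.
Proof.
elim/thom_ind: f => [|f f' IH IH'|a b eab f1 f2].
- by rewrite tcmp0l.
- by rewrite tcmpDl IH IH'.
by rewrite (tcmp_tens _ _ _ (addr0 a) (addr0 b) eab) !cmp1r sgn0r scale1r.
Qed.

Lemma tdif_tid (X : C * D) i (e : 0 + diota g = i) : dif e (tid X) = 0.
Proof.
have e1 : diota g + 0 = i by rewrite addrC.
rewrite [LHS](tdif_tens e (addr0 0) (add0r _) (add0r _) e1 e) !dif_dgid.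
by rewrite (lin0 (tens_linl _ _)) (lin0 (tens_linr _ _)) scaler0 addr0.
Qed.

Lemma tdif_tcmp (X Y Z : C * D) i j k i' j' l (e : i + j = k)
    (ek : k + diota g = l) (ei : i + diota g = i') (ej : j + diota g = j')
    (e1 : i' + j = l) (e2 : i + j' = l) (f : thom Y Z i) (h : thom X Y j) :
  dif ek (tcmp e f h) =
    tcmp e1 (dif ei f) h + sgn (diota g) i *: tcmp e2 f (dif ej h).
Proof.
elim/thom_ind: f => [|f f' IH IH'|a b eab f1 f2].
- by rewrite dif0 !tcmp0l dif0 scaler0 addr0.
- by rewrite difD !tcmpDl difD IH IH' scalerDr addrACA.
elim/thom_ind: h => [|h h' IH IH'|c d ecd h1 h2].
- by rewrite dif0 !tcmp0r dif0 scaler0 addr0.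
- by rewrite difD !tcmpDr difD IH IH' scalerDr addrACA.
have E := deg_cc eab ecd e.
rewrite (tcmp_tens _ _ _ erefl erefl E) difZ.
rewrite [dif ek _](tdif_tens ek E erefl erefl (deg_dl E ek) (deg_dr E ek)).
rewrite [dif ei _](tdif_tens ei eab erefl erefl (deg_dl eab ei) (deg_dr eab ei)).
rewrite [dif ej _](tdif_tens ej ecd erefl erefl (deg_dl ecd ej) (deg_dr ecd ej)).
rewrite tcmpDl tcmpDr tcmpZl tcmpZr.
have dA (x y : degrees g) : x + diota g + y = x + y + diota g by rewrite addrAC.
have dB (x y : degrees g) : x + (y + diota g) = x + y + diota g.
  by rewrite addrA.
rewrite (tcmp_tens _ _ _ (dA a c) erefl (deg_dl E ek)).
rewrite (tcmp_tens _ _ _ erefl (dA b d) (deg_dr E ek)).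
rewrite (tcmp_tens _ _ _ (dB a c) erefl (deg_dl E ek)).
rewrite (tcmp_tens _ _ _ erefl (dB b d) (deg_dr E ek)).
rewrite (dif_cmp erefl erefl erefl erefl (dA a c) (dB a c)).
rewrite (dif_cmp erefl erefl erefl erefl (dA b d) (dB b d)).
rewrite (linD (tens_linl _ _)) (linD (tens_linr _ _)).
rewrite !(linZ (tens_linl _ _)) !(linZ (tens_linr _ _)).
rewrite !(scalerDr, scalerA) -!addrA.
rewrite [RHS]addrACA -[RHS]addrA.
have E1 := sgnK (diota g) b.
congr (_ + (_ *: _ + (_ *: _ + _ *: _)));
  rewrite -?eab !(sgnDr, sgnDl) ?(sgnC b (diota g)).
- by ring: E1.
- by ring.
- by ring: E1.
Qed.

Definition tensor_dgcat : dgcat g :=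
  @DGCat g (C * D)%type thom tid tcmp tcmp_linl tcmp_linr tcmpA tcmp1l tcmp1r
    tdif_tid tdif_tcmp.
End TensorDGCat.

Section Shift.
Variables (g : ground) (C : dgcat g).

(* Shift i X is q^i X. *)
Record shobj := Shift { shdeg : degrees g; shbase : C }.

Lemma deg_sh_dif (G : zmodType) (c i j l m : G) :
  l + c = m -> l + i - j + c = m + i - j.
Proof. by move=> <-; rewrite -!addrA; congr (_ + _); rewrite addrA addrC. Qed.

Lemma deg_sh_cmp (G : zmodType) (h i j l1 l2 l : G) :
  l1 + l2 = l -> (l1 + j - h) + (l2 + i - j) = l + i - h.
Proof.
move=> <-; rewrite (addrAC l1 j) -(addrA (l1 - h)) [j + (_ - j)]addrC subrK.
by rewrite addrAC addrA.
Qed.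

Lemma deg_sh (G : zmodType) (i j k l : G) : k + j - i = l -> k = l + i - j.
Proof. by move=> <-; rewrite subrK addrK. Qed.

Section ShiftHom.
Variables (M : dgmod g) (i j : degrees g).
Definition sh_dif l m (e : l + diota g = m) (f : M (l + i - j)) :
  M (m + i - j) := sgn (diota g) j *: dif (deg_sh_dif i j e) f.
Lemma sh_dif_linear l m (e : l + diota g = m) : linear (sh_dif e).
Proof. exact/lin_scale/dif_linear. Qed.
Lemma sh_dif_dif l m n (e : l + diota g = m) (e' : m + diota g = n) x :
  sh_dif e' (sh_dif e x) = 0.
Proof. by rewrite /sh_dif difZ dif_dif !scaler0. Qed.
Definition sh_dgmod : dgmod g :=
  @DGMod g (fun l => M (l + i - j)) sh_dif sh_dif_linear sh_dif_dif.
End ShiftHom.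

Definition sh_hom (X Y : shobj) : dgmod g :=
  sh_dgmod (dghom (shbase X) (shbase Y)) (shdeg X) (shdeg Y).

(* For f of degree k in C, shmor e f is the element f^j_i of degree
   l = k + j - i.  With these elements, the differential and the composition
   of S(C) are given by dif_shmor and cmp_shmor below. *)
Definition shmor (X Y : C) i j k l (e : k + j - i = l) (f : dghom X Y k) :
  sh_hom (Shift i X) (Shift j Y) l := gcast (deg_sh e) f.

Definition sh_cmp (X Y Z : shobj) k l m (e : k + l = m) (f : sh_hom Y Z k)
    (h : sh_hom X Y l) : sh_hom X Z m :=
  cmp (deg_sh_cmp (shdeg Z) (shdeg X) (shdeg Y) e) f h.

Definition sh_id (X : shobj) : sh_hom X X 0 :=
  match X with Shift i Y =>
    shmor (etrans (congr1 (fun j => j - i) (add0r i)) (subrr i)) (dgid Y)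
  end.

Lemma cmp_castl (X Y Z : C) i i' j k (e : i = i') (e1 : i' + j = k)
    (e2 : i + j = k) (f : dghom Y Z i) (h : dghom X Y j) :
  cmp e1 (gcast e f) h = cmp e2 f h.
Proof. by subst i'; exact: cmp_irr. Qed.

Lemma cmp_castr (X Y Z : C) i j j' k (e : j = j') (e1 : i + j' = k)
    (e2 : i + j = k) (f : dghom Y Z i) (h : dghom X Y j) :
  cmp e1 f (gcast e h) = cmp e2 f h.
Proof. by subst j'; exact: cmp_irr. Qed.

Lemma dif_gcast (M : dgmod g) i i' j (e : i = i') (e1 : i' + diota g = j)
    (e2 : i + diota g = j) (x : M i) :
  dif e1 (gcast e x) = dif e2 x.
Proof. by subst i'; exact: dif_irr. Qed.

Lemma sh_cmp_linl (X Y Z : shobj) k l m (e : k + l = m) (h : sh_hom X Y l) :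
  linear (fun f : sh_hom Y Z k => sh_cmp e f h).
Proof. exact: cmp_linl. Qed.
Lemma sh_cmp_linr (X Y Z : shobj) k l m (e : k + l = m) (f : sh_hom Y Z k) :
  linear (fun h : sh_hom X Y l => sh_cmp e f h).
Proof. exact: cmp_linr. Qed.
Lemma sh_cmpA (W X Y Z : shobj) i j k ij jk l
    (e1 : i + j = ij) (e2 : ij + k = l) (e3 : j + k = jk) (e4 : i + jk = l)
    (f : sh_hom Y Z i) (h : sh_hom X Y j) (u : sh_hom W X k) :
  sh_cmp e4 f (sh_cmp e3 h u) = sh_cmp e2 (sh_cmp e1 f h) u.
Proof. exact: cmpA. Qed.
Lemma sh_cmp1l (X Y : shobj) i (e : 0 + i = i) (f : sh_hom X Y i) :
  sh_cmp e (sh_id Y) f = f.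
Proof.
case: Y f => j Y f.
by rewrite /sh_cmp /= /shmor (cmp_castl _ _ (add0r _)) cmp1l.
Qed.
Lemma sh_cmp1r (X Y : shobj) i (e : i + 0 = i) (f : sh_hom X Y i) :
  sh_cmp e f (sh_id X) = f.
Proof.
case: X f => j X f.
by rewrite /sh_cmp /= /shmor (cmp_castr _ _ (addr0 _)) cmp1r.
Qed.
Lemma sh_dif_id (X : shobj) i (e : 0 + diota g = i) : dif e (sh_id X) = 0.
Proof.
case: X => j X; rewrite /= /sh_dif /shmor.
have e2 : 0 + diota g = i + j - j by rewrite addrK.
by rewrite (dif_gcast _ _ e2) dif_dgid scaler0.
Qed.
Lemma sh_dif_cmp (X Y Z : shobj) i j k i' j' l (e : i + j = k)
    (ek : k + diota g = l) (ei : i + diota g = i') (ej : j + diota g = j')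
    (e1 : i' + j = l) (e2 : i + j' = l) (f : sh_hom Y Z i) (h : sh_hom X Y j) :
  dif ek (sh_cmp e f h) =
    sh_cmp e1 (dif ei f) h + sgn (diota g) i *: sh_cmp e2 f (dif ej h).
Proof.
case: X Y Z f h => [x X] [y Y] [z Z] f h /=; rewrite /sh_cmp /sh_dif /=.
rewrite cmpZl cmpZr.
rewrite (dif_cmp _ _ (deg_sh_dif y z ei) (deg_sh_dif x y ej)
  (deg_sh_cmp z x y e1) (deg_sh_cmp z x y e2)).
rewrite scalerDr !scalerA; congr (_ + _ *: _).
rewrite !(sgnDr, sgnN).
have E := sgnK (diota g) z; by ring: E.
Qed.

Definition shift_dgcat : dgcat g :=
  @DGCat g shobj sh_hom sh_id sh_cmp sh_cmp_linl sh_cmp_linr sh_cmpA sh_cmp1l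
    sh_cmp1r sh_dif_id sh_dif_cmp.

Lemma dif_shmor (X Y : C) i j k k' l l' (e : k + j - i = l)
    (e' : k' + j - i = l') (ek : k + diota g = k') (el : l + diota g = l')
    (f : dghom X Y k) :
  dif el (shmor e f) = sgn (diota g) j *: shmor e' (dif ek f).
Proof.
rewrite /= /sh_dif; congr (_ *: _); rewrite /shmor /=; subst k'.
have E : k + diota g = l' + i - j by rewrite -e' subrK addrK.
rewrite (dif_gcast _ _ E); move: (deg_sh e') => E'.
by case: _ / E' E => E; exact: dif_irr.
Qed.

Lemma cmp_shmor (X Y Z : C) i j m k k' k'' l l' l'' (e : k + j - i = l)
    (e' : k' + m - j = l') (e'' : k'' + m - i = l'') (ek : k' + k = k'')
    (el : l' + l = l'') (h : dghom Y Z k') (f : dghom X Y k) :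
  sh_cmp el (shmor e' h) (shmor e f) = shmor e'' (cmp ek h f).
Proof.
rewrite /sh_cmp /shmor /=; move: (deg_sh_cmp _ _ _ _) (deg_sh e'') => /= E2 E1.
case: _ / E1 E2 => E2; move: E2 (deg_sh e) (deg_sh e') => E2 a b.
by case: _ / a E2 => E2; case: _ / b E2 => E2; exact: cmp_irr.
Qed.
End Shift.
Arguments Shift {g C}.
Arguments shmor {g C X Y i j k l} e f.

Section AddMx.
Variables (g : ground) (I J : Type) (M : I -> J -> lmodType (scalars g)).

Definition mxhom : Type := forall a b, M a b.
HB.instance Definition _ := gen_eqMixin mxhom.
HB.instance Definition _ := gen_choiceMixin mxhom.

Lemma mxhomP (x y : mxhom) : (forall a b, x a b = y a b) -> x = y.
Proof.
by move=> E; apply: functional_extensionality_dep => a;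
  apply: functional_extensionality_dep => b; exact: E.
Qed.

Definition mxzero : mxhom := fun _ _ => 0.
Definition mxopp (x : mxhom) : mxhom := fun a b => - x a b.
Definition mxadd (x y : mxhom) : mxhom := fun a b => x a b + y a b.
Definition mxscale c (x : mxhom) : mxhom := fun a b => c *: x a b.
Lemma mxaddA : associative mxadd.
Proof. by move=> x y z; apply: mxhomP => a b; exact: addrA. Qed.
Lemma mxaddC : commutative mxadd.
Proof. by move=> x y; apply: mxhomP => a b; exact: addrC. Qed.
Lemma mxadd0 : left_id mxzero mxadd.
Proof. by move=> x; apply: mxhomP => a b; exact: add0r. Qed.
Lemma mxaddN : left_inverse mxzero mxopp mxadd.
Proof. by move=> x; apply: mxhomP => a b; exact: addNr. Qed.
HB.instance Definition _ := GRing.isZmodule.Build mxhom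
  mxaddA mxaddC mxadd0 mxaddN.
Lemma mxscalerA c d x : mxscale c (mxscale d x) = mxscale (c * d) x.
Proof. by apply: mxhomP => a b; exact: scalerA. Qed.
Lemma mxscale1r : left_id 1 mxscale.
Proof. by move=> x; apply: mxhomP => a b; exact: scale1r. Qed.
Lemma mxscalerDr : right_distributive mxscale +%R.
Proof. by move=> c x y; apply: mxhomP => a b; exact: scalerDr. Qed.
Lemma mxscalerDl x : {morph mxscale^~ x : c d / c + d}.
Proof. by move=> c d; apply: mxhomP => a b; exact: scalerDl. Qed.
HB.instance Definition _ := GRing.Zmodule_isLmodule.Build (scalars g) mxhom
  mxscalerA mxscale1r mxscalerDr mxscalerDl.

Lemma mxaddE (x y : mxhom) a b : (x + y) a b = x a b + y a b.
Proof. by []. Qed.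
Lemma mxscaleE c (x : mxhom) a b : (c *: x) a b = c *: x a b.
Proof. by []. Qed.
End AddMx.

Section Add.
Variables (g : ground) (C : dgcat g).

(* Sum X, for X : A -> C, is the formal direct sum of the X a for a in A. *)
Record sumobj := Sum { sumidx : finType; sumfam :> sumidx -> C }.

Section SumHom.
Variables (I J : Type) (M : I -> J -> dgmod g).
Definition sum_dif i j (e : i + diota g = j)
    (f : mxhom (fun a b => M a b i)) : mxhom (fun a b => M a b j) :=
  fun a b => dif e (f a b).
Lemma sum_dif_linear i j (e : i + diota g = j) : linear (sum_dif e).
Proof. by move=> c x y; apply: mxhomP => a b; exact: dif_linear. Qed.
Lemma sum_dif_dif i j k (e : i + diota g = j) (e' : j + diota g = k) x :
  sum_dif e' (sum_dif e x) = 0.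
Proof. by apply: mxhomP => a b; exact: dif_dif. Qed.
Definition sum_dgmod : dgmod g :=
  @DGMod g (fun i => mxhom (fun a b => M a b i)) sum_dif sum_dif_linear
    sum_dif_dif.
End SumHom.

(* Morphisms X -> Y are matrices f with f a b : X b -> Y a. *)
Definition sum_hom (X Y : sumobj) : dgmod g :=
  sum_dgmod (fun (a : sumidx Y) (b : sumidx X) => dghom (X b) (Y a)).

Definition sum_id (X : sumobj) : sum_hom X X 0 := fun a b =>
  match b =P a with
  | ReflectT e => ecast c (dghom (X b) (X c) 0) e (dgid (X b))
  | ReflectF _ => 0
  end.

Arguments sum_id : clear implicits.

Definition sum_cmp (X Y Z : sumobj) i j k (e : i + j = k)
    (f : sum_hom Y Z i) (h : sum_hom X Y j) : sum_hom X Z k :=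
  fun a c => \sum_(b : sumidx Y) cmp e (f a b) (h b c).

Lemma sum_id_diag (X : sumobj) (a : sumidx X) : sum_id X a a = dgid (X a).
Proof.
by rewrite /sum_id; case: eqP => // e; rewrite (eq_irrelevance e erefl).
Qed.
Lemma sum_id_off (X : sumobj) (a b : sumidx X) : b != a -> sum_id X a b = 0.
Proof. by rewrite /sum_id; case: eqP. Qed.

Lemma sum_cmp_linl (X Y Z : sumobj) k l m (e : k + l = m) (h : sum_hom X Y l) :
  linear (fun f : sum_hom Y Z k => sum_cmp e f h).
Proof.
move=> s x y; apply: mxhomP => a c; rewrite mxaddE mxscaleE /sum_cmp.
rewrite scaler_sumr -big_split /=; apply: eq_bigr => b _.
exact: (cmp_linl e (h b c)).
Qed.
Lemma sum_cmp_linr (X Y Z : sumobj) k l m (e : k + l = m) (f : sum_hom Y Z k) :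
  linear (fun h : sum_hom X Y l => sum_cmp e f h).
Proof.
move=> s x y; apply: mxhomP => a c; rewrite mxaddE mxscaleE /sum_cmp.
rewrite scaler_sumr -big_split /=; apply: eq_bigr => b _.
exact: (cmp_linr e (f a b)).
Qed.
Lemma sum_cmpA (W X Y Z : sumobj) i j k ij jk l
    (e1 : i + j = ij) (e2 : ij + k = l) (e3 : j + k = jk) (e4 : i + jk = l)
    (f : sum_hom Y Z i) (h : sum_hom X Y j) (u : sum_hom W X k) :
  sum_cmp e4 f (sum_cmp e3 h u) = sum_cmp e2 (sum_cmp e1 f h) u.
Proof.
apply: mxhomP => a d; rewrite /sum_cmp.
under eq_bigr => b _ do rewrite cmp_sumr.
under [RHS]eq_bigr => c _ do rewrite cmp_suml.
rewrite exchange_big /=; apply: eq_bigr => c _; apply: eq_bigr => b _.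
exact: cmpA.
Qed.
Lemma sum_cmp1l (X Y : sumobj) i (e : 0 + i = i) (f : sum_hom X Y i) :
  sum_cmp e (sum_id Y) f = f.
Proof.
apply: mxhomP => a c; rewrite /sum_cmp (bigD1 a) //= sum_id_diag cmp1l.
by rewrite big1 ?addr0 // => b ba; rewrite sum_id_off // cmp0l.
Qed.
Lemma sum_cmp1r (X Y : sumobj) i (e : i + 0 = i) (f : sum_hom X Y i) :
  sum_cmp e f (sum_id X) = f.
Proof.
apply: mxhomP => a c; rewrite /sum_cmp (bigD1 c) //= sum_id_diag cmp1r.
by rewrite big1 ?addr0 // => b bc; rewrite sum_id_off ?cmp0r // eq_sym.
Qed.
Lemma sum_dif_id (X : sumobj) i (e : 0 + diota g = i) : dif e (sum_id X) = 0.
Proof.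
apply: mxhomP => a b; rewrite /= /sum_dif; have [->|ba] := eqVneq b a.
  by rewrite sum_id_diag dif_dgid.
by rewrite sum_id_off // dif0.
Qed.
Lemma sum_dif_cmp (X Y Z : sumobj) i j k i' j' l (e : i + j = k)
    (ek : k + diota g = l) (ei : i + diota g = i') (ej : j + diota g = j')
    (e1 : i' + j = l) (e2 : i + j' = l) (f : sum_hom Y Z i)
    (h : sum_hom X Y j) :
  dif ek (sum_cmp e f h) =
    sum_cmp e1 (dif ei f) h + sgn (diota g) i *: sum_cmp e2 f (dif ej h).
Proof.
apply: mxhomP => a c; rewrite mxaddE mxscaleE /= /sum_dif /sum_cmp.
rewrite dif_sum scaler_sumr -big_split /=.
by apply: eq_bigr => b _; exact: dif_cmp.
Qed.

Definition sum_dgcat : dgcat g :=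
  @DGCat g sumobj sum_hom sum_id sum_cmp sum_cmp_linl sum_cmp_linr sum_cmpA
    sum_cmp1l sum_cmp1r sum_dif_id sum_dif_cmp.
End Add.
Arguments Sum {g C}.

Lemma tw_cancel (V : zmodType) (a b u v w : V) :
  - b - a + (- u + w) + (a + b - v) + (u + v - w) = 0.
Proof.
rewrite -opprD [b + a]addrC (addrAC (- (a + b)) (- u + w) (a + b - v)) addKr.
rewrite -[RHS](addNr (u + v - w)); congr (_ + _).
by rewrite !opprD opprK addrA; congr (_ + _); exact: addrC.
Qed.

Section Twist.
Variables (g : ground) (C : dgcat g).

Definition maurer_cartan (X : C) (alpha : dghom X X (diota g)) : Prop :=
  dif (erefl (diota g + diota g)) alpha + cmp erefl alpha alpha = 0.

Record twobj := Tw {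
  twbase : C;
  twmor : dghom twbase twbase (diota g);
  twmc : maurer_cartan twmor
}.

Lemma deg_swap (G : zmodType) (c i j : G) : i + c = j -> c + i = j.
Proof. by rewrite addrC. Qed.

Section TwistHom.
Variables X Y : twobj.
Definition tw_dif i j (e : i + diota g = j)
    (f : dghom (twbase X) (twbase Y) i) :
    dghom (twbase X) (twbase Y) j :=
  dif e f + cmp (deg_swap e) (twmor Y) f -
    sgn (diota g) i *: cmp e f (twmor X).
Lemma tw_dif_linear i j (e : i + diota g = j) : linear (tw_dif e).
Proof.
move=> c x y; rewrite /tw_dif -!scaleNr.
exact: (lin_add (lin_add (dif_linear e) (cmp_linr (deg_swap e) (twmor Y)))
  (lin_scale (- sgn (diota g) i) (cmp_linl e (twmor X))) c x y).
Qed.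
Lemma tw_dif_dif i j k (e : i + diota g = j) (e' : j + diota g = k) x :
  tw_dif e' (tw_dif e x) = 0.
Proof.
rewrite /tw_dif !(difD, cmpDl, cmpDr) -!scaleNr !(difZ, cmpZl, cmpZr) dif_dif.
have E1 : diota g + diota g + i = k by rewrite -e' -e addrC addrA.
have E2 : i + (diota g + diota g) = k by rewrite -e' -e addrA.
rewrite (dif_cmp _ _ erefl e E1 (deg_swap e')).
rewrite (dif_cmp _ _ e erefl e' E2).
rewrite (cmpA erefl E1) (cmpA (deg_swap e) e') -(cmpA e e' erefl E2).
have := congr1 (fun u => cmp E1 u x) (twmc Y).
rewrite /= cmpDl cmp0l => /eqP; rewrite addr_eq0 => /eqP ->.
have := congr1 (fun u => cmp E2 x u) (twmc X).
rewrite /= cmpDr cmp0r => /eqP; rewrite addr_eq0 => /eqP ->.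
have -> : sgn (diota g) j = - sgn (diota g) i.
  by rewrite -e sgnDr sgn_iota mulrN1.
rewrite sgn_iota opprK add0r !scalerDr !scalerA !scalerN !mulNr mulrN !sgnK.
rewrite !scaleNr !scale1r opprK; exact: tw_cancel.
Qed.
Definition tw_dgmod : dgmod g :=
  @DGMod g (fun i => dghom (twbase X) (twbase Y) i) tw_dif tw_dif_linear
    tw_dif_dif.
End TwistHom.

(* Identities and composition are those of C; only the differential changes. *)
Definition tw_id (X : twobj) : tw_dgmod X X 0 := dgid (twbase X).
Definition tw_cmp (X Y Z : twobj) i j k (e : i + j = k)
    (f : tw_dgmod Y Z i) (h : tw_dgmod X Y j) : tw_dgmod X Z k :=
  cmp (C := C) e f h.

Lemma tw_cmp_linl (X Y Z : twobj) k l m (e : k + l = m) (h : tw_dgmod X Y l) :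
  linear (fun f : tw_dgmod Y Z k => tw_cmp e f h).
Proof. exact: cmp_linl. Qed.
Lemma tw_cmp_linr (X Y Z : twobj) k l m (e : k + l = m) (f : tw_dgmod Y Z k) :
  linear (fun h : tw_dgmod X Y l => tw_cmp e f h).
Proof. exact: cmp_linr. Qed.
Lemma tw_cmpA (W X Y Z : twobj) i j k ij jk l
    (e1 : i + j = ij) (e2 : ij + k = l) (e3 : j + k = jk) (e4 : i + jk = l)
    (f : tw_dgmod Y Z i) (h : tw_dgmod X Y j) (u : tw_dgmod W X k) :
  tw_cmp e4 f (tw_cmp e3 h u) = tw_cmp e2 (tw_cmp e1 f h) u.
Proof. exact: cmpA. Qed.
Lemma tw_cmp1l (X Y : twobj) i (e : 0 + i = i) (f : tw_dgmod X Y i) :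
  tw_cmp e (tw_id Y) f = f.
Proof. exact: cmp1l. Qed.
Lemma tw_cmp1r (X Y : twobj) i (e : i + 0 = i) (f : tw_dgmod X Y i) :
  tw_cmp e f (tw_id X) = f.
Proof. exact: cmp1r. Qed.
Lemma tw_dif_id (X : twobj) i (e : 0 + diota g = i) : dif e (tw_id X) = 0.
Proof.
rewrite /= /tw_dif /tw_id dif_dgid add0r sgn0r scale1r.
have E : diota g = i by rewrite -e add0r.
by move: e; case: _ / E => e; rewrite cmp1l cmp1r subrr.
Qed.
Lemma tw_dif_cmp (X Y Z : twobj) i j k i' j' l (e : i + j = k)
    (ek : k + diota g = l) (ei : i + diota g = i') (ej : j + diota g = j')
    (e1 : i' + j = l) (e2 : i + j' = l) (f : tw_dgmod Y Z i)
    (h : tw_dgmod X Y j) :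
  dif ek (tw_cmp e f h) =
    tw_cmp e1 (dif ei f) h + sgn (diota g) i *: tw_cmp e2 f (dif ej h).
Proof.
rewrite /= /tw_dif /tw_cmp (dif_cmp e ek ei ej e1 e2).
rewrite (cmpA (deg_swap ei) e1) -(cmpA e ek ej e2) -!scaleNr.
rewrite !(cmpDl, cmpDr, cmpZl, cmpZr).
rewrite -(cmpA ei e1 (deg_swap ej) e2) !(scalerDr, scalerA).
have -> : sgn (diota g) k = sgn (diota g) i * sgn (diota g) j
  by rewrite -e sgnDr.
rewrite !mulrN !scaleNr -!addrA; congr (_ + _).
by rewrite addrCA; congr (_ + _); rewrite [RHS]addrCA addKr.
Qed.

Definition tw_dgcat : dgcat g :=
  @DGCat g twobj tw_dgmod tw_id tw_cmp tw_cmp_linl tw_cmp_linr tw_cmpA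
    tw_cmp1l tw_cmp1r tw_dif_id tw_dif_cmp.
End Twist.
Arguments Tw {g C}.

(* A dg functor is given by its object map F0 and its maps F on hom modules;
   it is fully faithful if the latter are isomorphisms of dg modules, i.e.,
   bijective in each degree. *)
Definition is_dgfunctor (g : ground) (A B : dgcat g) (F0 : A -> B)
    (F : forall X Y k, dghom X Y k -> dghom (F0 X) (F0 Y) k) : Prop :=
  [/\ forall X Y k, linear (F X Y k),
      forall X Y i j (e : i + diota g = j) (f : dghom X Y i),
        F _ _ _ (dif e f) = dif e (F _ _ _ f),
      forall X, F X X 0 (dgid X) = dgid (F0 X)
    & forall X Y Z i j k (e : i + j = k) (f : dghom Y Z i) (h : dghom X Y j),
        F _ _ _ (cmp e f h) = cmp e (F _ _ _ f) (F _ _ _ h)].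

Definition fully_faithful (g : ground) (A B : dgcat g) (F0 : A -> B)
    (F : forall X Y k, dghom X Y k -> dghom (F0 X) (F0 Y) k) : Prop :=
  forall X Y k, bijective (F X Y k).

Section Star.
Variables (g : ground) (C D : dgcat g).

Definition star_shift (P : shift_dgcat C * shift_dgcat D) :
    shift_dgcat (tensor_dgcat C D) :=
  Shift (C := tensor_dgcat C D) (shdeg P.1 + shdeg P.2)
    (shbase P.1, shbase P.2).

Definition star_sum (P : sum_dgcat C * sum_dgcat D) :
    sum_dgcat (tensor_dgcat C D) :=
  Sum (C := tensor_dgcat C D) (sumidx P.1 * sumidx P.2)%type
    (fun ab => (sumfam ab.1, sumfam ab.2)).

Definition star_twmor (X : C) (Y : D) (alpha : dghom X X (diota g))
    (beta : dghom Y Y (diota g)) :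
    dghom (C := tensor_dgcat C D) (X, Y) (X, Y) (diota g) :=
  tens (addr0 (diota g)) alpha (dgid Y) + tens (add0r (diota g)) (dgid X) beta.

Lemma star_twmc (X : C) (Y : D) alpha beta :
  maurer_cartan alpha -> maurer_cartan beta ->
  maurer_cartan (@star_twmor X Y alpha beta).
Proof.
move=> mcX mcY; rewrite /maurer_cartan /star_twmor.
pose i := diota g.
have e20 : i + i + 0 = i + i := addr0 _.
have e02 : 0 + (i + i) = i + i := add0r _.
rewrite difD.
rewrite [X in X + _ + _](tdif_tens erefl _ erefl (add0r i) e20 erefl).
rewrite [X in _ + X + _](tdif_tens erefl _ (add0r i) erefl erefl e02).
rewrite !dif_dgid (lin0 (tens_linl _ _)) (lin0 (tens_linr _ _)).
rewrite scaler0 addr0 add0r sgn0r scale1r.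
rewrite [cmp _ _ _]tcmpDl !tcmpDr.
rewrite (tcmp_tens erefl _ _ erefl (addr0 0) e20).
rewrite (tcmp_tens erefl _ _ (addr0 i) (add0r i) erefl).
rewrite (tcmp_tens erefl _ _ (add0r i) (addr0 i) erefl).
rewrite (tcmp_tens erefl _ _ (addr0 0) erefl e02).
rewrite /= !(cmp1l, cmp1r) !(sgn0l, sgn0r) sgn_iota !scale1r scaleN1r.
rewrite addrACA !addrA.
rewrite -(linD (tens_linl e20 (dgid Y))) mcX (lin0 (tens_linl _ _)) add0r.
rewrite [tens erefl alpha beta + _]addrC addrK.
by rewrite -(linD (tens_linr e02 (dgid X))) mcY (lin0 (tens_linr _ _)).
Qed.

Definition star_tw (P : tw_dgcat C * tw_dgcat D) :
    tw_dgcat (tensor_dgcat C D) :=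
  Tw (C := tensor_dgcat C D) (twbase P.1, twbase P.2)
    (star_twmor (twmor P.1) (twmor P.2)) (star_twmc (twmc P.1) (twmc P.2)).
End Star.

(* Main.v *)
Require Import Defs.
From HB Require Import structures.
From mathcomp Require Import all_boot all_order all_algebra.
From mathcomp Require Import ring.
Set Implicit Arguments.
Unset Strict Implicit.
Unset Printing Implicit Defensive.
Import GRing.Theory.
Local Open Scope ring_scope.

(** On hom modules each of the three operations is, up to signs and
relabelling of degrees, the identity of a tensor product, applied to each
matrix entry in the additive case; so the content is that it respects the
structure and is bijective.

Both sides of every dg functor identity are linear in each morphism, hence it
suffices to compare them on pure tensors ([tens_dgfunctor]); there they become
identities between explicit tensors.

- Shifts: after expanding the differentials and composites, both sides are
  multiples of the same tensors, and what remains is an identity between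
  products of signs [sgn x y].  It follows from biadditivity and symmetry of
  the pairing and from the fact that signs square to one.  An inverse is given
  by the inverse relabelling of degrees with the same sign, so that the two
  signs cancel.

- Sums: composition and differential are computed entry by entry, and the
  matrix product over pairs of indices factors because a tensor product of
  finite sums is a sum of tensor products.  The hom module of a sum is the
  finite direct sum of its entries, and tensor products commute with finite
  direct sums: an inverse places the tensor in the entry [((a, b), (a', b'))]
  as the tensor product of two matrices with a single nonzero entry, and adds
  up over all entries.  Finiteness of the index sets is what makes this work.

- Twists: hom modules, identities and composition are those of the untwisted
  categories, so the map is the identity and only the differential has to be
  compared.  Composing [f (x) h] with [alpha (x) id + id (x) beta] yields the
  four terms of the twisted differentials of [f] and [h], with the signs
  prescribed by the tensor product. *)

(** * Tensor products of linear maps *)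

Lemma lin_id (K : pzRingType) (U : lmodType K) : linear (fun x : U => x).
Proof. by []. Qed.

(** A common form for the maps needed below and for their inverses: the tensor
product of two families of linear maps that relabel degrees, with a scalar
that may depend on the degrees of the two factors. *)
Section TwistedTensorMap.
Variables (g : ground) (M N M' N' : degrees g -> lmodType (scalars g)).
Variables (s t : degrees g -> degrees g).
Variable c : degrees g -> degrees g -> scalars g.
Variables (phi : forall a, M a -> M' (s a)) (psi : forall b, N b -> N' (t b)).
Hypothesis lin_phi : forall a, linear (@phi a).
Hypothesis lin_psi : forall b, linear (@psi b).
Variables (k k' : degrees g) (est : forall a b, a + b = k -> s a + t b = k').

Definition tmap : tensor M N k -> tensor M' N' k' :=
  tlift (fun a b (e : a + b = k) m n =>
    c a b *: tens (est e) (phi m) (psi n)).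

Let tmap_linl a b (e : a + b = k) n :
  linear (fun m => c a b *: tens (est e) (@phi a m) (@psi b n)).
Proof.
apply: lin_scale.
exact: (lin_comp (tens_linl (M := M') (est e) (psi n)) (@lin_phi a)).
Qed.
Let tmap_linr a b (e : a + b = k) m :
  linear (fun n => c a b *: tens (est e) (@phi a m) (@psi b n)).
Proof.
apply: lin_scale.
exact: (lin_comp (tens_linr (N := N') (est e) (phi m)) (@lin_psi b)).
Qed.

Lemma tmap_linear : linear tmap.
Proof. exact: tlift_linear tmap_linl tmap_linr. Qed.

Lemma tmap_tens a b (e : a + b = k) (e' : s a + t b = k') m n :
  tmap (tens e m n) = c a b *: tens e' (phi m) (psi n).
Proof.
by rewrite /tmap (tlift_tens tmap_linl tmap_linr) (tens_irr (est e) e').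
Qed.
End TwistedTensorMap.

(** Pure tensors generate, and differentials and composites are linear in each
variable; so compatibility with them can be tested on pure tensors. *)
Lemma tens_dgfunctor (g : ground) (A B E : dgcat g)
    (F0 : tensor_dgcat A B -> E)
    (F : forall P Q k, dghom P Q k -> dghom (F0 P) (F0 Q) k) :
  (forall P Q k, linear (F P Q k)) ->
  (forall (P Q : tensor_dgcat A B) i j a b (e : i + diota g = j)
      (eab : a + b = i) (f : dghom P.1 Q.1 a) (h : dghom P.2 Q.2 b),
    F P Q j (dif e (tens eab f h : dghom P Q i)) =
      dif e (F P Q i (tens eab f h))) ->
  (forall P, F P P 0 (dgid P) = dgid (F0 P)) ->
  (forall (P Q R : tensor_dgcat A B) i j k a b c d (e : i + j = k)
      (eab : a + b = i) (ecd : c + d = j)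
      (f1 : dghom Q.1 R.1 a) (f2 : dghom Q.2 R.2 b)
      (h1 : dghom P.1 Q.1 c) (h2 : dghom P.2 Q.2 d),
    F P R k (cmp e (tens eab f1 f2 : dghom Q R i) (tens ecd h1 h2)) =
      cmp e (F Q R i (tens eab f1 f2)) (F P Q j (tens ecd h1 h2))) ->
  is_dgfunctor F.
Proof.
move=> linF difF idF cmpF; split=> // [P Q i j e f|P Q R i j k e f h].
  apply: (tensor_lin_ext (f := fun x : dghom P Q i => F P Q j (dif e x))
    (h := fun x : dghom P Q i => dif e (F P Q i x))).
  - exact: lin_comp (linF P Q j) (dif_linear e).
  - exact: lin_comp (dif_linear e) (linF P Q i).
  - by move=> a b eab m n; exact: difF.
move: h; apply: (tensor_lin_ext
  (f := fun h : dghom P Q j => F P R k (cmp e f h))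
  (h := fun h : dghom P Q j => cmp e (F Q R i f) (F P Q j h))).
- exact: lin_comp (linF P R k) (cmp_linr e f).
- exact: lin_comp (cmp_linr e (F Q R i f)) (linF P Q j).
move=> c d ecd h1 h2; move: f; apply: (tensor_lin_ext
  (f := fun f : dghom Q R i => F P R k (cmp e f (tens ecd h1 h2 : dghom P Q j)))
  (h := fun f : dghom Q R i =>
    cmp e (F Q R i f) (F P Q j (tens ecd h1 h2)))).
- exact: lin_comp (linF P R k) (cmp_linl e _).
- exact: lin_comp (cmp_linl e _) (linF Q R i).
by move=> a b eab f1 f2; exact: cmpF.
Qed.

(** * Shifts *)

Lemma sgnNl (g : ground) (a b : degrees g) : sgn (- a) b = sgn a b.
Proof. by rewrite sgnC sgnN sgnC. Qed.

Section DegreeCasts.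
Variable g : ground.

Lemma gcast_id (M : dgmod g) i (e : i = i) (x : M i) : gcast e x = x.
Proof. by rewrite (eq_irrelevance e erefl). Qed.

Lemma gcast_tens (M N : dgmod g) a b k k' (e : a + b = k) (e' : a + b = k')
    (E : k = k') (m : M a) (n : N b) :
  gcast (M := tensor_dgmod M N) E (tens e m n) = tens e' m n.
Proof. by case: _ / E e' => e'; exact: tens_irr. Qed.

Lemma tens_gcast (M N : dgmod g) a a' b b' k (e : a + b = k)
    (e' : a' + b' = k) (ea : a = a') (eb : b = b') (m : M a) (n : N b) :
  tens e' (gcast ea m) (gcast eb n) = tens e m n.
Proof. by subst a' b'; exact: tens_irr. Qed.

Lemma gcast_linear (M : dgmod g) i j (e : i = j) : linear (@gcast g M i j e).
Proof. by subst j. Qed.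

Lemma shmor_linear (E : dgcat g) (X Y : E) (i j k l : degrees g)
    (e : k + j - i = l) : linear (@shmor g E X Y i j k l e).
Proof. exact: gcast_linear. Qed.
End DegreeCasts.

Section StarShift.
Variables (g : ground) (C D : dgcat g).

Lemma deg_star (i i' j j' a b m : degrees g) :
  a + b = m -> (a + i - i') + (b + j - j') = m + (i + j) - (i' + j').
Proof. by move=> <-; rewrite opprD addrACA; congr (_ + _); rewrite addrACA. Qed.

Lemma deg_unstar (i i' j j' u v m : degrees g) :
  u + v = m + (i + j) - (i' + j') -> (u + i' - i) + (v + j' - j) = m.
Proof. by move/(deg_star i' i j' j) => ->; rewrite subrK addrK. Qed.

(** The sign [sgn k j' * sgn i (j' + l + j)] attached to [f] and [h] of degrees
[k] and [l], in terms of the degrees [a = k + i' - i] and [b = l + j' - j] of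
the shifted morphisms: [j' + l + j] and [b] differ by twice [j]. *)
Definition shift_sgn (i i' j j' a b : degrees g) : scalars g :=
  sgn (a + i - i') j' * sgn i b.

(** Since the degree [a] part of a shifted hom module is the degree [a + i - i']
part of the original one, the underlying maps are identities. *)
Definition star_shift_hom (P Q : tensor_dgcat (shift_dgcat C) (shift_dgcat D))
    (m : degrees g) : dghom P Q m -> dghom (star_shift P) (star_shift Q) m :=
  tmap (M' := dghom (shbase P.1) (shbase Q.1))
    (N' := dghom (shbase P.2) (shbase Q.2))
    (s := fun a => a + shdeg P.1 - shdeg Q.1)
    (t := fun b => b + shdeg P.2 - shdeg Q.2)
    (shift_sgn (shdeg P.1) (shdeg Q.1) (shdeg P.2) (shdeg Q.2))
    (fun a (f : dghom P.1 Q.1 a) => f)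
    (fun b (h : dghom P.2 Q.2 b) => h)
    (fun a b =>
      @deg_star (shdeg P.1) (shdeg Q.1) (shdeg P.2) (shdeg Q.2) a b m).

Lemma star_shift_hom_linear P Q m : linear (@star_shift_hom P Q m).
Proof. by apply: tmap_linear. Qed.

Section OnTensors.
Variables (X X' : C) (Y Y' : D) (i i' j j' : degrees g).
Let P : tensor_dgcat (shift_dgcat C) (shift_dgcat D) := (Shift i X, Shift j Y).
Let P' : tensor_dgcat (shift_dgcat C) (shift_dgcat D) :=
  (Shift i' X', Shift j' Y').

Lemma star_shift_hom_tens (m a b : degrees g) (e : a + b = m)
    (e' : (a + i - i') + (b + j - j') = m + (i + j) - (i' + j'))
    (f : dghom (C := shift_dgcat C) (Shift i X) (Shift i' X') a)
    (h : dghom (C := shift_dgcat D) (Shift j Y) (Shift j' Y') b) :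
  @star_shift_hom P P' m (tens e f h) =
  shift_sgn i i' j j' a b *: tens (M := dghom X X') (N := dghom Y Y') e' f h.
Proof. by apply: (tmap_tens _ _ _ _ e e' f h). Qed.

Lemma star_shift_hom_shmor (k l p q m : degrees g)
    (f : dghom X X' k) (h : dghom Y Y' l)
    (ep : k + i' - i = p) (eq_ : l + j' - j = q) (em : p + q = m)
    (e : k + l + (i' + j') - (i + j) = m) :
  @star_shift_hom P P' m (tens em (shmor ep f) (shmor eq_ h)) =
  (sgn k j' * sgn i (j' + l + j)) *:
    shmor (C := tensor_dgcat C D) (X := (X, Y)) (Y := (X', Y')) e
      (tens erefl f h).
Proof.
have E := deg_star i i' j j' em.
rewrite (star_shift_hom_tens em E) /shift_sgn; congr (_ * _ *: _).
- by rewrite -(deg_sh ep).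
- by rewrite -eq_ !(sgnDr, sgnN); ring.
have E' : k + l = m + (i + j) - (i' + j').
  by rewrite -E -(deg_sh ep) -(deg_sh eq_).
by rewrite /shmor (tens_gcast E') (gcast_tens _ E').
Qed.
End OnTensors.

Lemma star_shift_hom_dif (P Q : tensor_dgcat (shift_dgcat C) (shift_dgcat D))
    (i j a b : degrees g) (e : i + diota g = j) (eab : a + b = i)
    (f : dghom P.1 Q.1 a) (h : dghom P.2 Q.2 b) :
  star_shift_hom (dif e (tens eab f h : dghom P Q i)) =
  dif e (star_shift_hom (tens eab f h : dghom P Q i)).
Proof.
have E1 := deg_dl eab e; have E2 := deg_dr eab e.
rewrite [dif e _ as X in star_shift_hom X](tdif_tens e eab erefl erefl E1 E2).
case: P Q f h => [[i1 X] [j1 Y]] [[i2 X'] [j2 Y']] f h.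
rewrite (linD (@star_shift_hom_linear _ _ _)).
rewrite (linZ (@star_shift_hom_linear _ _ _)).
have E3 := deg_star i1 i2 j1 j2 E1; have E4 := deg_star i1 i2 j1 j2 E2.
have E0 := deg_star i1 i2 j1 j2 eab.
rewrite (star_shift_hom_tens E1 E3) (star_shift_hom_tens E2 E4).
rewrite (star_shift_hom_tens eab E0) difZ.
rewrite [dif e _]/(sh_dif _ _) /sh_dif [in RHS]/dif /=.
rewrite (tdif_tens _ E0 (deg_sh_dif i1 i2 erefl) (deg_sh_dif j1 j2 erefl) E3 E4).
rewrite [tens E3 (dif erefl f) h](linZ (tens_linl E3 h)).
rewrite [tens E4 f (dif erefl h)](linZ (tens_linr E4 f)).
rewrite !(scalerDr, scalerA); congr (_ *: _ + _ *: _).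
  by rewrite /shift_sgn /= !(sgnDl, sgnDr, sgnNl); ring.
rewrite /shift_sgn /= !(sgnDl, sgnDr, sgnN, sgnNl) (sgnC i1 (diota g)).
have K := sgnK (diota g) i2; ring: K.
Qed.

Lemma star_shift_hom_id (P : tensor_dgcat (shift_dgcat C) (shift_dgcat D)) :
  star_shift_hom (dgid P) = dgid (star_shift P).
Proof.
case: P => [[i X] [j Y]].
have e : 0 + 0 + (i + j) - (i + j) = 0 by rewrite !add0r subrr.
rewrite [LHS](star_shift_hom_shmor _ _ _ _ _ e).
rewrite sgn0l mul1r addr0 sgnDr sgnK scale1r.
have e00 : 0 + 0 = 0 + (i + j) - (i + j) by rewrite addr0 add0r subrr.
by rewrite /= /shmor !(gcast_tens _ e00).
Qed.

Lemma star_shift_hom_cmp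
    (P Q R : tensor_dgcat (shift_dgcat C) (shift_dgcat D))
    (i j k a b c d : degrees g) (e : i + j = k)
    (eab : a + b = i) (ecd : c + d = j)
    (f1 : dghom Q.1 R.1 a) (f2 : dghom Q.2 R.2 b)
    (h1 : dghom P.1 Q.1 c) (h2 : dghom P.2 Q.2 d) :
  star_shift_hom (cmp e (tens eab f1 f2 : dghom Q R i)
    (tens ecd h1 h2 : dghom P Q j)) =
  cmp e (star_shift_hom (tens eab f1 f2 : dghom Q R i))
    (star_shift_hom (tens ecd h1 h2 : dghom P Q j)).
Proof.
have E1 := deg_cc eab ecd e.
rewrite [cmp e _ _ as X in star_shift_hom X](tcmp_tens e eab ecd erefl erefl E1).
case: P Q R f1 f2 h1 h2
  => [[i1 X1] [j1 Y1]] [[i2 X2] [j2 Y2]] [[i3 X3] [j3 Y3]] f1 f2 h1 h2.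
rewrite (linZ (@star_shift_hom_linear _ _ _)).
have E2 := deg_star i1 i3 j1 j3 E1.
have E3 := deg_star i2 i3 j2 j3 eab.
have E4 := deg_star i1 i2 j1 j2 ecd.
rewrite (star_shift_hom_tens E1 E2) (star_shift_hom_tens eab E3).
rewrite (star_shift_hom_tens ecd E4) cmpZl cmpZr !scalerA.
rewrite [in RHS]/cmp /= /sh_cmp.
rewrite (tcmp_tens _ E3 E4
  (deg_sh_cmp i3 i1 i2 erefl) (deg_sh_cmp j3 j1 j2 erefl) E2).
rewrite scalerA; congr (_ *: _).
rewrite /shift_sgn /= !(sgnDl, sgnDr, sgnN, sgnNl).
(* The pairings of the intermediate shifts i2 and j2 occur twice each. *)
rewrite !(sgnC b) !(sgnC j2) !(sgnC j3).
have K1 := sgnK i2 j3; have K2 := sgnK i2 b; have K3 := sgnK c j2.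
have K4 := sgnK i1 j2; have K5 := sgnK i2 j2.
ring: K1 K2 K3 K4 K5.
Qed.

Lemma star_shift_dgfunctor : is_dgfunctor star_shift_hom.
Proof.
apply: tens_dgfunctor.
- exact: star_shift_hom_linear.
- exact: star_shift_hom_dif.
- exact: star_shift_hom_id.
- exact: star_shift_hom_cmp.
Qed.

(** Shifting degrees back and forth is the identity, up to the casts along
[a + i - i' + i' - i = a]. *)
Lemma tens_shmor (X X' : C) (Y Y' : D) (i i' j j' m a b : degrees g)
    (e : a + b = m) (e' : (a + i - i' + i' - i) + (b + j - j' + j' - j) = m)
    (f : dghom X X' (a + i - i')) (h : dghom Y Y' (b + j - j')) :
  tens e' (shmor erefl f) (shmor erefl h) =
  tens (M := sh_hom (Shift i X) (Shift i' X'))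
    (N := sh_hom (Shift j Y) (Shift j' Y')) e f h.
Proof.
have degK c (x x' : degrees g) : c + x - x' + x' - x = c.
  by rewrite subrK addrK.
(* With variable target degrees k and l the equations can be eliminated. *)
have indep k l (ek : a + i - i' + i' - i = k) (el : b + j - j' + j' - j = l)
    (ekl : k + l = m) :
  tens e' (shmor erefl f) (shmor erefl h) = tens ekl (shmor ek f) (shmor el h).
  case: _ / ek ekl => ekl; case: _ / el ekl => ekl.
  by rewrite (eq_irrelevance ekl e').
by rewrite (indep _ _ (degK a i i') (degK b j j') e) /shmor !gcast_id.
Qed.

Lemma star_shift_hom_bij P Q m : bijective (@star_shift_hom P Q m).
Proof.
case: P Q => [[i X] [j Y]] [[i' X'] [j' Y']].
pose G := tmap (M := dghom X X') (N := dghom Y Y')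
  (M' := sh_hom (Shift i X) (Shift i' X'))
  (N' := sh_hom (Shift j Y) (Shift j' Y'))
  (fun u v => sgn u j' * sgn i (j' + v + j))
  (fun u f => shmor (i := i) (j := i') erefl f)
  (fun v h => shmor (i := j) (j := j') erefl h)
  (fun u v => @deg_unstar i i' j j' u v m).
have linG : linear G by apply: tmap_linear => *; exact: shmor_linear.
have Gtens u v (e : u + v = m + (i + j) - (i' + j')) (f : dghom X X' u)
    (h : dghom Y Y' v) : G (tens e f h) = (sgn u j' * sgn i (j' + v + j)) *:
      tens (deg_unstar e) (shmor erefl f) (shmor erefl h).
  by apply: tmap_tens => *; exact: shmor_linear.
have linF := @star_shift_hom_linear (Shift i X, Shift j Y)
  (Shift i' X', Shift j' Y') m.
exists G.
  apply: (tensor_lin_ext (lin_comp linG linF) (@lin_id _ _)) => a b e f h.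
  have E := deg_star i i' j j' e.
  rewrite (star_shift_hom_tens e E) (linZ linG) Gtens (tens_shmor e) scalerA.
  rewrite -[RHS]scale1r; congr (_ *: _).
  rewrite /shift_sgn !(sgnDl, sgnDr, sgnN, sgnNl).
  have K1 := sgnK a j'; have K2 := sgnK i j'; have K3 := sgnK i' j'.
  have K4 := sgnK i b; have K5 := sgnK i j.
  ring: K1 K2 K3 K4 K5.
apply: (tensor_lin_ext (lin_comp linF linG) (@lin_id _ _)) => u v e f h.
have E : u + v + (i' + j') - (i + j) = m by rewrite e subrK addrK.
rewrite Gtens (linZ linF) (star_shift_hom_shmor _ _ _ _ _ E) scalerA.
by rewrite /shmor (gcast_tens _ e) mulrACA !sgnK mul1r scale1r.
Qed.
End StarShift.

(** * Finite sums *)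

Section MatrixUnits.
Variables (g : ground) (I J : finType) (M : I -> J -> lmodType (scalars g)).

Definition mxunit a b (x : M a b) : mxhom M :=
  dfwith (fun a' b' => 0 : M a' b') (dfwith (fun b' => 0 : M a b') x).

Lemma mxunit_in a b (x : M a b) : mxunit x a b = x.
Proof. by rewrite /mxunit dfwith_in dfwith_in. Qed.

Lemma mxunit_out a b a' b' (x : M a b) :
  (a, b) != (a', b') -> mxunit x a' b' = 0.
Proof.
rewrite xpair_eqE negb_and /mxunit; have [<-|aa _] := eqVneq a a'.
  by rewrite dfwith_in => /= bb; rewrite dfwith_out.
by rewrite dfwith_out.
Qed.

Lemma mxunit_linear a b : linear (@mxunit a b).
Proof.
move=> c x y; apply: mxhomP => a' b'; rewrite mxaddE mxscaleE.
have [[<- <-]|ne] := eqVneq (a, b) (a', b'); first by rewrite !mxunit_in.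
by rewrite !mxunit_out // scaler0 addr0.
Qed.

Lemma mxentry_linear a b : linear (fun x : mxhom M => x a b).
Proof. by []. Qed.

Lemma mxunit_sum (x : mxhom M) : \sum_(p : I * J) mxunit (x p.1 p.2) = x.
Proof.
apply: mxhomP => a b; rewrite (lin_sum (mxentry_linear a b)).
rewrite (bigD1 (a, b)) //= mxunit_in big1 ?addr0 // => -[a' b'] ne.
exact: mxunit_out.
Qed.
End MatrixUnits.

Section StarSum.
Variables (g : ground) (C D : dgcat g).

Definition star_sum_hom (P Q : tensor_dgcat (sum_dgcat C) (sum_dgcat D))
    (m : degrees g) (x : dghom P Q m) : dghom (star_sum P) (star_sum Q) m :=
  fun ab ab' => tmap (M := dghom P.1 Q.1) (N := dghom P.2 Q.2)
    (M' := dghom (sumfam ab'.1) (sumfam ab.1))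
    (N' := dghom (sumfam ab'.2) (sumfam ab.2)) (fun _ _ => 1)
    (fun k (f : dghom P.1 Q.1 k) => f ab.1 ab'.1)
    (fun l (h : dghom P.2 Q.2 l) => h ab.2 ab'.2) (fun _ _ e => e) x.

Lemma star_sum_hom_tens (P Q : tensor_dgcat (sum_dgcat C) (sum_dgcat D))
    (k l m : degrees g) (e : k + l = m) (f : dghom P.1 Q.1 k)
    (h : dghom P.2 Q.2 l) (ab : sumidx (star_sum Q))
    (ab' : sumidx (star_sum P)) :
  star_sum_hom (tens e f h : dghom P Q m) ab ab' =
  tens e (f ab.1 ab'.1) (h ab.2 ab'.2).
Proof. by rewrite -[RHS]scale1r; apply: (tmap_tens _ _ _ _ e e f h). Qed.

Lemma star_sum_hom_linear P Q m : linear (@star_sum_hom P Q m).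
Proof. by move=> c x y; apply: mxhomP => ab ab'; apply: tmap_linear. Qed.

Lemma star_sum_dgfunctor : is_dgfunctor star_sum_hom.
Proof.
apply: tens_dgfunctor => [P Q m|P Q i j a b e eab f h|P|
    P Q R i j k a b c d e eab ecd f1 f2 h1 h2].
- exact: star_sum_hom_linear.
- have difE := tdif_tens e eab erefl erefl (deg_dl eab e) (deg_dr eab e).
  rewrite [dif e _ as X in star_sum_hom X]difE.
  rewrite (linD (@star_sum_hom_linear _ _ _)).
  rewrite (linZ (@star_sum_hom_linear _ _ _)).
  apply: mxhomP => x y; rewrite mxaddE mxscaleE !star_sum_hom_tens.
  rewrite [RHS]/(dif e _) star_sum_hom_tens /= /sum_dif.
  by rewrite [RHS]difE.
- apply: mxhomP => -[a b] [a' b'].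
  rewrite [dgid P]/(tens _ _ _) star_sum_hom_tens /=.
  have [[-> ->]|ne] := eqVneq (a', b') (a, b); first by rewrite !sum_id_diag.
  (* Off the diagonal at least one of the two tensor factors vanishes. *)
  rewrite [RHS]sum_id_off //; move: ne; rewrite xpair_eqE negb_and.
  case/orP=> ne; first by rewrite sum_id_off // (lin0 (tens_linl _ _)).
  by rewrite [X in tens _ _ X]sum_id_off // (lin0 (tens_linr _ _)).
have cmpE := tcmp_tens e eab ecd erefl erefl (deg_cc eab ecd e).
rewrite [cmp e _ _ as X in star_sum_hom X]cmpE.
rewrite (linZ (@star_sum_hom_linear _ _ _)).
apply: mxhomP => x y; rewrite mxscaleE star_sum_hom_tens.
rewrite [LHS]/= [RHS]/= /sum_cmp.
rewrite (lin_sum (tens_linl _ _)).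
under eq_bigr => z1 _ do rewrite (lin_sum (tens_linr _ _)).
rewrite pair_big scaler_sumr /=; apply: eq_bigr => z _.
by rewrite !star_sum_hom_tens [RHS]cmpE.
Qed.

Lemma star_sum_hom_bij P Q m : bijective (@star_sum_hom P Q m).
Proof.
pose U ab ab' := tmap (M := dghom (sumfam ab'.1) (sumfam ab.1))
    (N := dghom (sumfam ab'.2) (sumfam ab.2))
    (M' := dghom P.1 Q.1) (N' := dghom P.2 Q.2) (fun _ _ => 1)
    (fun k (f : dghom (P.1 ab'.1) (Q.1 ab.1) k) =>
      mxunit (M := fun a a' => dghom (P.1 a') (Q.1 a) k) f)
    (fun l (h : dghom (P.2 ab'.2) (Q.2 ab.2) l) =>
      mxunit (M := fun b b' => dghom (P.2 b') (Q.2 b) l) h)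
    (fun k l (e : k + l = m) => e).
have linU ab ab' : linear (U ab ab').
  by apply: tmap_linear => *; exact: mxunit_linear.
have Utens ab ab' k l (e : k + l = m) f h : U ab ab' (tens e f h) =
    tens (M := dghom P.1 Q.1) (N := dghom P.2 Q.2) e (mxunit f) (mxunit h).
  by rewrite -[RHS]scale1r; apply: tmap_tens => *; exact: mxunit_linear.
pose G (y : dghom (star_sum P) (star_sum Q) m) : dghom P Q m :=
  \sum_(p : sumidx (star_sum Q) * sumidx (star_sum P)) U p.1 p.2 (y p.1 p.2).
have linG : linear G.
  by apply: lin_bigsum => p; exact: lin_comp (linU _ _) (mxentry_linear _ _).
have linF := @star_sum_hom_linear P Q m.
exists G.
  apply: (tensor_lin_ext (lin_comp linG linF) (@lin_id _ _)) => k l e f h.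
  rewrite /G; under eq_bigr => p _ do rewrite star_sum_hom_tens Utens.
  rewrite -[in RHS](mxunit_sum f) -[in RHS](mxunit_sum h).
  rewrite (lin_sum (tens_linl _ _)).
  under [RHS]eq_bigr => z1 _ do rewrite (lin_sum (tens_linr _ _)).
  rewrite pair_big /=.
  (* G sums over ((a, b), (a', b')), the tensor product of the two expansions
     into matrix units over ((a, a'), (b, b')). *)
  pose swap (I J K L : Type) (p : (I * J) * (K * L)) : (I * K) * (J * L) :=
    ((p.1.1, p.2.1), (p.1.2, p.2.2)).
  by rewrite (reindex (@swap _ _ _ _)) //;
    exists (@swap _ _ _ _) => -[[? ?] [? ?]].
move=> y; rewrite /G (lin_sum linF); apply: mxhomP => ab ab'.
rewrite (lin_sum (mxentry_linear ab ab')).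
rewrite (bigD1 (ab, ab')) //= big1 => [|p ne].
  rewrite addr0; apply: (tensor_lin_ext
    (f := fun z => star_sum_hom (U ab ab' z) ab ab')
    (lin_comp (lin_comp (mxentry_linear ab ab') linF) (linU ab ab'))
    (@lin_id _ _)) => k l e f h.
  by rewrite Utens star_sum_hom_tens !mxunit_in.
apply: (tensor_lin_ext (f := fun z => star_sum_hom (U p.1 p.2 z) ab ab')
  (lin_comp (lin_comp (mxentry_linear ab ab') linF) (linU p.1 p.2))
  (h := fun=> 0)).
  by move=> c x z; rewrite scaler0 addr0.
move=> k l e f h; rewrite Utens star_sum_hom_tens.
have [eqp|nep] := eqVneq (p.1.1, p.2.1) (ab.1, ab'.1).
  rewrite [X in tens _ _ X]mxunit_out ?(lin0 (tens_linr _ _)) //.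
  apply: contraNneq ne => eqq.
  case: p {f h} eqp eqq => -[a b] [a' b'] /= [-> ->] [-> ->].
  by rewrite -!surjective_pairing.
by rewrite [X in tens _ X]mxunit_out ?(lin0 (tens_linl _ _)).
Qed.
End StarSum.

(** * Twists *)

Section StarTwist.
Variables (g : ground) (C D : dgcat g).

Definition star_tw_hom (P Q : tensor_dgcat (tw_dgcat C) (tw_dgcat D))
    (m : degrees g) (x : dghom P Q m) : dghom (star_tw P) (star_tw Q) m := x.

(** Composing with [alpha] on the right costs the sign of moving it past [h], and
composing with [beta] on the left that of moving it past [f].  The first sign
reduces the total degree [a + b] in the twisted differential of [f (x) h] to
the degree [a] in that of [f]; the second is the sign in front of the
differential of [h]. *)
Lemma star_tw_hom_dif (P Q : tensor_dgcat (tw_dgcat C) (tw_dgcat D))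
    (i j a b : degrees g) (e : i + diota g = j) (eab : a + b = i)
    (f : dghom P.1 Q.1 a) (h : dghom P.2 Q.2 b) :
  star_tw_hom (dif e (tens eab f h : dghom P Q i)) =
  dif e (star_tw_hom (tens eab f h : dghom P Q i)).
Proof.
have E1 := deg_dl eab e; have E2 := deg_dr eab e.
rewrite /star_tw_hom [LHS](tdif_tens e eab erefl erefl E1 E2).
case: P Q f h => [[X al mal] [Y be mbe]] [[X' al' mal'] [Y' be' mbe']] f h.
rewrite [LHS]/= [RHS]/= /tw_dif /= /star_twmor.
rewrite (tdif_tens e eab erefl erefl E1 E2) tcmpDl tcmpDr.
rewrite (tcmp_tens _ _ eab (deg_swap erefl) (add0r b) E1).
rewrite (tcmp_tens _ _ eab (add0r a) (deg_swap erefl) E2).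
rewrite (tcmp_tens _ eab _ erefl (addr0 b) E1).
rewrite (tcmp_tens _ eab _ (addr0 a) erefl E2).
rewrite !(cmp1l, cmp1r) sgn0l sgn0r !scale1r -!scaleNr.
rewrite !(linD (tens_linl E1 h)) (linZ (tens_linl E1 h)).
rewrite !(linD (tens_linr E2 f)) (linZ (tens_linr E2 f)).
rewrite !(scalerDr, scalerA).
rewrite -eab sgnDr (sgnC b) !(mulNr, mulrN) -mulrA sgnK mulr1.
by rewrite [LHS]addrACA; congr (_ + _); exact: addrACA.
Qed.

Lemma star_tw_dgfunctor : is_dgfunctor star_tw_hom.
Proof. by apply: tens_dgfunctor => //; exact: star_tw_hom_dif. Qed.

Lemma star_tw_hom_bij P Q m : bijective (@star_tw_hom P Q m).
Proof. by exists id. Qed.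
End StarTwist.

(** * The three functors *)

Theorem proposition4p14 (g : ground) (C D : dgcat g) :
  (exists F : forall (P Q : tensor_dgcat (shift_dgcat C) (shift_dgcat D))
                (m : degrees g),
                dghom P Q m -> dghom (star_shift P) (star_shift Q) m,
    [/\ forall (X X' : C) (Y Y' : D) (i i' j j' k l p q m : degrees g)
          (f : dghom X X' k) (h : dghom Y Y' l)
          (ep : k + i' - i = p) (eq_ : l + j' - j = q) (em : p + q = m)
          (e : k + l + (i' + j') - (i + j) = m),
          F (Shift i X, Shift j Y) (Shift i' X', Shift j' Y') m
            (tens em (shmor ep f) (shmor eq_ h)) =
          (sgn k j' * sgn i (j' + l + j)) *:
            shmor (C := tensor_dgcat C D) (X := (X, Y)) (Y := (X', Y')) e
              (tens erefl f h),
        is_dgfunctor F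
      & fully_faithful F]) /\
  (exists F : forall (P Q : tensor_dgcat (sum_dgcat C) (sum_dgcat D))
                (m : degrees g),
                dghom P Q m -> dghom (star_sum P) (star_sum Q) m,
    [/\ forall (X X' : sum_dgcat C) (Y Y' : sum_dgcat D) (k l m : degrees g)
          (e : k + l = m) (f : dghom X' X k) (h : dghom Y' Y l)
          (a : sumidx X) (b : sumidx Y) (a' : sumidx X') (b' : sumidx Y'),
          F (X', Y') (X, Y) m (tens e f h) (a, b) (a', b') =
          tens e (f a a') (h b b'),
        is_dgfunctor F
      & fully_faithful F]) /\
  (exists F : forall (P Q : tensor_dgcat (tw_dgcat C) (tw_dgcat D))
                (m : degrees g),
                dghom P Q m -> dghom (star_tw P) (star_tw Q) m,
    [/\ forall (X X' : tw_dgcat C) (Y Y' : tw_dgcat D) (k l m : degrees g)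
          (e : k + l = m) (f : dghom X X' k) (h : dghom Y Y' l),
          F (X, Y) (X', Y') m (tens e f h) =
          tens e (f : dghom (twbase X) (twbase X') k)
                 (h : dghom (twbase Y) (twbase Y') l),
        is_dgfunctor F
      & fully_faithful F]).
Proof.
split; [|split].
- exists (@star_shift_hom g C D); split.
  + exact: star_shift_hom_shmor.
  + exact: star_shift_dgfunctor.
  + exact: star_shift_hom_bij.
- exists (@star_sum_hom g C D); split.
  + by move=> X X' Y Y' k l m e f h a b a' b'; exact: star_sum_hom_tens.
  + exact: star_sum_dgfunctor.
  + exact: star_sum_hom_bij.
- exists (@star_tw_hom g C D); split => //.
  + exact: star_tw_dgfunctor.
  + exact: star_tw_hom_bij.
Qed.
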